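(* For an integer $r\ge1$ let $f_r(x):=\sum_{m\ge0}\frac{(rm)!}{(m!)^r}x^m\in\mathbb{Z}[[x]]$, which is the diagonal of the rational power series $\frac{1}{1-(x_1+\cdots+x_r)}\in\mathbb{Z}[[x_1,\ldots,x_r]]$. Let $s$ be a positive integer and set $F_s:=\sum_{r=6}^{6+s-1}f_r$. Then for all but finitely many prime numbers $p$, the power series $(F_s)_{\vert p}$ is algebraic over $\mathbb{F}_p(x)$ of degree at least $p^{s/2}$. In particular, for any positive number $N$ there exists a power series with integer coefficients that is the diagonal of a rational function (a rational power series in $\mathbb{Z}[[x_1,\ldots,x_k]]$ for some $k$) whose reduction modulo $p$ is algebraic of degree at least $p^{N}$ over $\mathbb{F}_p(x)$ for all but finitely many primes $p$.
   Context: The diagonal of $g=\sum a(i_1,\ldots,i_k)x_1^{i_1}\cdots x_k^{i_k}$ is $\Delta(g)=\sum_{m\ge0}a(m,\ldots,m)x^m$. For $g=\sum a(m)x^m\in\mathbb{Z}[[x]]$, $g_{\vert p}:=\sum (a(m)\bmod p)x^m\in\mathbb{F}_p[[x]]$. The degree of an algebraic power series over $\mathbb{F}_p(x)$ is the degree of its minimal polynomial. *)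

(* Defs.v *)
From HB Require Import structures.
From mathcomp Require Import all_boot all_order all_algebra.
From mathcomp Require Import boolp reals exp.
From mathcomp Require Import mpoly.

Set Implicit Arguments.
Unset Strict Implicit.
Unset Printing Implicit Defensive.

Import Order.TTheory GRing.Theory Num.Theory.
Local Open Scope ring_scope.

(** * Univariate power series: the ring R[[x]]
    Multiplication is the Cauchy product. The ring laws are obtained from those
    of {poly R}, since the coefficients of a product up to degree N only depend
    on the truncations of its factors. *)

Record fps (R : Type) := FPS { fps_coef :> nat -> R }.

HB.instance Definition _ (R : Type) := gen_eqMixin (fps R).
HB.instance Definition _ (R : Type) := gen_choiceMixin (fps R).

Lemma fpsP (R : Type) (f g : fps R) : f =1 g -> f = g.
Proof. by case: f g => f [g] /= fg; congr FPS; apply/funext. Qed.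

Section FpsZmodule.
Variable R : zmodType.
Implicit Types f g h : fps R.

Definition fps_zero : fps R := FPS (fun=> 0).
Definition fps_opp f : fps R := FPS (fun n => - f n).
Definition fps_add f g : fps R := FPS (fun n => f n + g n).

Lemma fps_addA : associative fps_add.
Proof. by move=> f g h; apply: fpsP => n /=; rewrite addrA. Qed.
Lemma fps_addC : commutative fps_add.
Proof. by move=> f g; apply: fpsP => n /=; rewrite addrC. Qed.
Lemma fps_add0 : left_id fps_zero fps_add.
Proof. by move=> f; apply: fpsP => n /=; rewrite add0r. Qed.
Lemma fps_addN : left_inverse fps_zero fps_opp fps_add.
Proof. by move=> f; apply: fpsP => n /=; rewrite addNr. Qed.

HB.instance Definition _ :=
  GRing.isZmodule.Build (fps R) fps_addA fps_addC fps_add0 fps_addN.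

Lemma coef_fps0 n : (0 : fps R) n = 0. Proof. by []. Qed.
Lemma coef_fpsN f n : (- f) n = - f n. Proof. by []. Qed.
Lemma coef_fpsD f g n : (f + g) n = f n + g n. Proof. by []. Qed.

End FpsZmodule.

Section FpsRing.
Variable R : comNzRingType.
Implicit Types f g h : fps R.

Definition fps_one : fps R := FPS (fun n => (n == 0)%:R).
Definition fps_mul f g : fps R := FPS (fun n => \sum_(i < n.+1) f i * g (n - i)%N).

Definition fps_trunc N f : {poly R} := \poly_(i < N) f i.

Lemma coef_fps_mul N f g n : (n < N)%N ->
  fps_mul f g n = (fps_trunc N f * fps_trunc N g)`_n.
Proof.
move=> nN; rewrite coefM; apply: eq_bigr => i _; rewrite !coef_poly.
by rewrite (leq_ltn_trans (leq_ord i) nN) (leq_ltn_trans (leq_subr i n) nN).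
Qed.

Lemma fps_mulC : commutative fps_mul.
Proof.
by move=> f g; apply: fpsP => n; rewrite !(@coef_fps_mul n.+1)// mulrC.
Qed.

Lemma coef_trunc_mull N f g (p : {poly R}) n : (n < N)%N ->
  (fps_trunc N (fps_mul f g) * p)`_n = (fps_trunc N f * fps_trunc N g * p)`_n.
Proof.
move=> nN; rewrite !coefM; apply: eq_bigr => i _.
have iN := leq_ltn_trans (leq_ord i) nN.
by rewrite coef_poly iN (coef_fps_mul _ _ iN).
Qed.

Lemma fps_mulA : associative fps_mul.
Proof.
move=> f g h; apply: fpsP => n.
rewrite fps_mulC !(@coef_fps_mul n.+1)// !coef_trunc_mull//.
by rewrite (mulrC _ (fps_trunc n.+1 f)) mulrA.
Qed.

Lemma fps_mul1 : left_id fps_one fps_mul.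
Proof.
move=> f; apply: fpsP => n /=.
by rewrite big_ord_recl /= mul1r subn0 big1 ?addr0// => i _; rewrite mul0r.
Qed.

Lemma fps_mulD : left_distributive fps_mul +%R.
Proof.
move=> f g h; apply: fpsP => n /=; rewrite -big_split /=.
by apply: eq_bigr => i _; rewrite mulrDl.
Qed.

Lemma fps_one_neq0 : fps_one != 0.
Proof.
by apply/eqP => /(congr1 (fun f : fps R => f 0)) /eqP; rewrite /= oner_eq0.
Qed.

HB.instance Definition _ := GRing.Zmodule_isComNzRing.Build (fps R)
  fps_mulA fps_mulC fps_mul1 fps_mulD fps_one_neq0.

Lemma coef_fps1 n : (1 : fps R) n = (n == 0)%:R. Proof. by []. Qed.
Lemma coef_fpsM f g n : (f * g) n = \sum_(i < n.+1) f i * g (n - i)%N.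
Proof. by []. Qed.

Definition poly_fps (p : {poly R}) : fps R := FPS (fun n => p`_n).

Lemma poly_fps_is_zmod_morphism : zmod_morphism poly_fps.
Proof. by move=> p q; apply: fpsP => n /=; rewrite coefB. Qed.

Lemma poly_fps_is_monoid_morphism : monoid_morphism poly_fps.
Proof.
split=> [|p q]; apply: fpsP => n /=; first by rewrite coef1.
by rewrite coefM.
Qed.

HB.instance Definition _ :=
  GRing.isZmodMorphism.Build {poly R} (fps R) poly_fps poly_fps_is_zmod_morphism.
HB.instance Definition _ :=
  GRing.isMonoidMorphism.Build {poly R} (fps R) poly_fps
    poly_fps_is_monoid_morphism.

Lemma poly_fps_inj : injective poly_fps.
Proof.
move=> p q pq; apply/polyP => n.
by have := congr1 (fun f : fps R => f n) pq.
Qed.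

(* Classical unit ring structure, needed to view R[[x]] as an integral domain. *)
Definition fps_unit f : bool := `[< exists g, g * f = 1 >].
Definition fps_inv f : fps R :=
  if pselect (exists g, g * f = 1) is left fU then sval (cid fU) else f.

Lemma fps_mulVx : {in fps_unit, left_inverse 1 fps_inv *%R}.
Proof.
move=> f /asboolP fU; rewrite /fps_inv.
by case: pselect => // fU'; case: cid.
Qed.

Lemma fps_unitPl f g : g * f = 1 -> fps_unit f.
Proof. by move=> gf; apply/asboolP; exists g. Qed.

Lemma fps_invr_out : {in [predC fps_unit], fps_inv =1 id}.
Proof. by move=> f /asboolPn fNU; rewrite /fps_inv; case: pselect. Qed.

HB.instance Definition _ := GRing.ComNzRing_hasMulInverse.Build (fps R)
  fps_mulVx fps_unitPl fps_invr_out.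

End FpsRing.

Section FpsIdomain.
Variable R : idomainType.
Implicit Types f g : fps R.

Lemma fps_neq0_order f : f != 0 ->
  exists2 m, f m != 0 & forall i, (i < m)%N -> f i = 0.
Proof.
move=> f0; have exf : exists m, f m != 0.
  apply: contrapT => nex; move/eqP: f0; apply; apply: fpsP => n.
  by apply/eqP; apply: contrapT => /negP fn; apply: nex; exists n.
case: (ex_minnP exf) => m fm mmin; exists m => // i im.
by apply/eqP; apply: contraTT im => /mmin; rewrite -leqNgt.
Qed.

Lemma fps_mulf_eq0 : GRing.integral_domain_axiom (fps R).
Proof.
move=> f g fg0; apply/norP => -[/fps_neq0_order[m fm fmin]].
case/fps_neq0_order=> n gn gmin.
have := congr1 (fun h : fps R => h (m + n)%N) fg0.
have mmn : (m < (m + n).+1)%N by rewrite ltnS leq_addr.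
rewrite coef_fpsM (bigD1 (Ordinal mmn)) //= addKn big1 => [|i im].
  by rewrite addr0 => /eqP; rewrite mulf_eq0 (negPf fm) (negPf gn).
case: (ltngtP i m) => [/fmin ->|mi|/eqP]; first by rewrite mul0r.
  rewrite gmin ?mulr0// ltn_subLR ?ltn_add2r//.
  by rewrite -ltnS ltn_ord.
by move=> /eqP im'; case/eqP: im; apply: val_inj.
Qed.

HB.instance Definition _ :=
  GRing.ComUnitRing_isIntegral.Build (fps R) fps_mulf_eq0.

End FpsIdomain.

(** * Multivariate power series: the ring R[[x_1, ..., x_k]]
    A monomial is an element of 'X_{1..k}, as in {mpoly R[k]}. The product is
    the Cauchy product: the bounds on the degrees of the two factors in the sum
    are implied by its condition and only make the index type finite. *)

Record mfps (R : Type) (k : nat) := MFPS { mfps_coef :> 'X_{1..k} -> R }.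

HB.instance Definition _ (R : Type) k := gen_eqMixin (mfps R k).
HB.instance Definition _ (R : Type) k := gen_choiceMixin (mfps R k).

Lemma mfpsP (R : Type) k (f g : mfps R k) : f =1 g -> f = g.
Proof. by case: f g => f [g] /= fg; congr MFPS; apply/funext. Qed.

Section MfpsRing.
Variables (R : comNzRingType) (k : nat).
Implicit Types f g h : mfps R k.

Definition mfps_zero : mfps R k := MFPS (fun=> 0).
Definition mfps_opp f : mfps R k := MFPS (fun m => - f m).
Definition mfps_add f g : mfps R k := MFPS (fun m => f m + g m).

Lemma mfps_addA : associative mfps_add.
Proof. by move=> f g h; apply: mfpsP => m /=; rewrite addrA. Qed.
Lemma mfps_addC : commutative mfps_add.
Proof. by move=> f g; apply: mfpsP => m /=; rewrite addrC. Qed.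
Lemma mfps_add0 : left_id mfps_zero mfps_add.
Proof. by move=> f; apply: mfpsP => m /=; rewrite add0r. Qed.
Lemma mfps_addN : left_inverse mfps_zero mfps_opp mfps_add.
Proof. by move=> f; apply: mfpsP => m /=; rewrite addNr. Qed.

HB.instance Definition _ :=
  GRing.isZmodule.Build (mfps R k) mfps_addA mfps_addC mfps_add0 mfps_addN.

Definition mfps_one : mfps R k := MFPS (fun m => (m == 0%MM)%:R).
Definition mfps_mul f g : mfps R k := MFPS (fun m =>
  \sum_(h : 'X_{1..k < (mdeg m).+1, (mdeg m).+1} | m == (h.1 + h.2)%MM)
    f h.1 * g h.2).

Definition mfps_trunc N f : {mpoly R[k]} :=
  \sum_(m : 'X_{1..k < N}) f m *: 'X_[m].

Lemma coef_mfps_mul N f g m : (mdeg m < N)%N ->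
  mfps_mul f g m = (mfps_trunc N f * mfps_trunc N g)@_m.
Proof.
move=> mN; rewrite mcoeffM; apply: eq_bigr => -[h1 h2] _ /=.
by rewrite !mcoeff_mpoly// (leq_trans (bmdeg _) mN).
Qed.

Lemma mfps_mulC : commutative mfps_mul.
Proof.
move=> f g; apply: mfpsP => m.
by rewrite !(@coef_mfps_mul (mdeg m).+1)// mulrC.
Qed.

Lemma mcoeff_trunc_mull N f g (p : {mpoly R[k]}) m : (mdeg m < N)%N ->
  (mfps_trunc N (mfps_mul f g) * p)@_m
  = (mfps_trunc N f * mfps_trunc N g * p)@_m.
Proof.
move=> mN; rewrite [LHS]mcoeffM [RHS]mcoeffM; apply: eq_bigr => -[h1 h2] _ /=.
have h1N := leq_trans (bmdeg h1) mN.
by rewrite mcoeff_mpoly// (coef_mfps_mul _ _ h1N).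
Qed.

Lemma mfps_mulA : associative mfps_mul.
Proof.
move=> f g h; apply: mfpsP => m.
rewrite mfps_mulC !(@coef_mfps_mul (mdeg m).+1)// !mcoeff_trunc_mull//.
by rewrite (mulrC _ (mfps_trunc _ f)) mulrA.
Qed.

Lemma mfps_mul1 : left_id mfps_one mfps_mul.
Proof.
move=> f; apply: mfpsP => m.
have trunc1 : mfps_trunc (mdeg m).+1 mfps_one = 1.
  apply/mpolyP => i; rewrite mcoeff1; case: (ltnP (mdeg i) (mdeg m).+1) => im.
    by rewrite mcoeff_mpoly.
  rewrite raddf_sum big1 /= => [|j _].
    by case: eqP im => // ->; rewrite mdeg0.
  rewrite mcoeffZ mcoeffX; have [ji|_] := eqVneq (j : 'X_{1..k}) i.
    by move: (bmdeg j); rewrite ji ltnNge im.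
  by rewrite mulr0.
by rewrite (@coef_mfps_mul (mdeg m).+1)// trunc1 mul1r mcoeff_mpoly.
Qed.

Lemma mfps_mulD : left_distributive mfps_mul +%R.
Proof.
move=> f g h; apply: mfpsP => m /=; rewrite -big_split /=.
by apply: eq_bigr => i _; rewrite mulrDl.
Qed.

Lemma mfps_one_neq0 : mfps_one != 0.
Proof.
apply/eqP => /(congr1 (fun f : mfps R k => f 0%MM)) /eqP.
by rewrite /= eqxx oner_eq0.
Qed.

HB.instance Definition _ := GRing.Zmodule_isComNzRing.Build (mfps R k)
  mfps_mulA mfps_mulC mfps_mul1 mfps_mulD mfps_one_neq0.

Definition mpoly_mfps (p : {mpoly R[k]}) : mfps R k := MFPS (fun m => p@_m).

Lemma mpoly_mfps_is_zmod_morphism : zmod_morphism mpoly_mfps.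
Proof. by move=> p q; apply: mfpsP => m /=; rewrite mcoeffB. Qed.

Lemma mpoly_mfps_is_monoid_morphism : monoid_morphism mpoly_mfps.
Proof.
split=> [|p q]; apply: mfpsP => m /=; first by rewrite mcoeff1.
by rewrite mcoeffM.
Qed.

HB.instance Definition _ :=
  GRing.isZmodMorphism.Build {mpoly R[k]} (mfps R k) mpoly_mfps
    mpoly_mfps_is_zmod_morphism.
HB.instance Definition _ :=
  GRing.isMonoidMorphism.Build {mpoly R[k]} (mfps R k) mpoly_mfps
    mpoly_mfps_is_monoid_morphism.

(* g = P / Q with denominators cleared; Q need not be invertible in R[[x]]. *)
Definition is_ratio (P Q : {mpoly R[k]}) g : Prop :=
  Q != 0 /\ mpoly_mfps Q * g = mpoly_mfps P.

Definition rational_mfps g : Prop := exists P Q, is_ratio P Q g.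

Definition diagonal g : fps R := FPS (fun m => g [multinom m | _ < k]).

End MfpsRing.

(** * Degree of a power series over K(x)
    K(x) is {fraction {poly K}} and K((x)) is {fraction (fps K)}, the former
    being included in the latter through ratfun_laurent. *)

Section Degree.
Variable K : fieldType.

Lemma frac_repr (A : idomainType) (u : {fraction A}) :
  u = tofrac \n_(repr u) / tofrac \d_(repr u).
Proof.
have d0 : tofrac \d_(repr u) != 0 by rewrite tofrac_eq0 denom_ratioP.
apply: (mulIf d0); rewrite mulfVK// -{1}[u]reprK; unlock FracField.tofrac.
rewrite -[LHS]FracField.pi_mul; apply/eqmodP.
rewrite /= FracField.equivfE /FracField.mulf.
by rewrite !numden_Ratio ?mulf_neq0 ?denom_ratioP ?oner_eq0// !mulr1 mulrC.
Qed.

Definition ratfun_laurent (u : {fraction {poly K}}) : {fraction (fps K)} :=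
  tofrac (poly_fps \n_(repr u)) / tofrac (poly_fps \d_(repr u)).

Let phi (p : {poly K}) : {fraction (fps K)} := tofrac (poly_fps p).

Let phi_neq0 p : p != 0 -> phi p != 0.
Proof.
rewrite /phi tofrac_eq0; apply: contraNneq => p0.
by apply/eqP/poly_fps_inj; rewrite p0 rmorph0.
Qed.

Lemma ratfun_laurent_frac (a b : {poly K}) : b != 0 ->
  ratfun_laurent (tofrac a / tofrac b) = phi a / phi b.
Proof.
move=> b0; set u := _ / _; have d0 : \d_(repr u) != 0 by apply: denom_ratioP.
have /eqP := frac_repr u; rewrite {1}/u eqr_div ?tofrac_eq0// -!tofracM tofrac_eq.
move=> /eqP adnb; apply/eqP; rewrite eqr_div ?phi_neq0// /phi -!tofracM -!rmorphM.
by rewrite adnb.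
Qed.

Lemma ratfun_laurent_is_zmod_morphism : zmod_morphism ratfun_laurent.
Proof.
move=> u v; rewrite (frac_repr u) (frac_repr v).
set a := \n_(repr u); set c := \n_(repr v).
have b0 : \d_(repr u) != 0 by apply: denom_ratioP.
have d0 : \d_(repr v) != 0 by apply: denom_ratioP.
move: b0 d0; set b := \d_(repr u); set d := \d_(repr v) => b0 d0.
rewrite -mulNr addf_div ?tofrac_eq0// -tofracN -!tofracM -tofracD.
rewrite !ratfun_laurent_frac ?mulf_neq0// -mulNr addf_div ?phi_neq0//.
by rewrite /phi !(rmorphM, rmorphD, rmorphN).
Qed.

Lemma ratfun_laurent_is_monoid_morphism : monoid_morphism ratfun_laurent.
Proof.
split=> [|u v].
  rewrite -[X in ratfun_laurent X](divr1 1) -tofrac1.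
  by rewrite ratfun_laurent_frac ?oner_neq0// /phi !rmorph1 divr1.
rewrite (frac_repr u) (frac_repr v) mulf_div -!tofracM.
rewrite !ratfun_laurent_frac ?mulf_neq0 ?denom_ratioP// mulf_div.
by rewrite /phi !rmorphM.
Qed.

HB.instance Definition _ :=
  GRing.isZmodMorphism.Build {fraction {poly K}} {fraction (fps K)}
    ratfun_laurent ratfun_laurent_is_zmod_morphism.
HB.instance Definition _ :=
  GRing.isMonoidMorphism.Build {fraction {poly K}} {fraction (fps K)}
    ratfun_laurent ratfun_laurent_is_monoid_morphism.

Definition is_minpoly (f : fps K) (P : {poly {fraction {poly K}}}) : Prop :=
  [/\ P \is monic, root (map_poly ratfun_laurent P) (tofrac f)
    & forall Q, Q != 0 -> root (map_poly ratfun_laurent Q) (tofrac f) ->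
        (size P <= size Q)%N].

Definition algebraic_of_degree (f : fps K) (d : nat) : Prop :=
  exists2 P, is_minpoly f P & size P = d.+1.

End Degree.

Definition fps_mod (p : nat) (f : fps int) : fps 'F_p :=
  FPS (fun m => (f m)%:~R).

Lemma dvdn_expn_fact (r m : nat) : (m`! ^ r %| (r * m)`!)%N.
Proof.
elim: r => [|r IHr]; first by rewrite expn0 dvd1n.
rewrite expnS mulSn -(bin_fact (leq_addr (r * m) m)) addKn.
by apply/dvdn_mull/dvdn_mul.
Qed.

(* The division in nat is exact, by dvdn_expn_fact. *)
Definition multinomial_fps (r : nat) : fps int :=
  FPS (fun m => ((r * m)`! %/ m`! ^ r)%N%:Z).

Definition multinomial_sum (s : nat) : fps int :=
  \sum_(6 <= r < 6 + s) multinomial_fps r.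

(* Main.v *)
Require Import Defs.
From HB Require Import structures.
From mathcomp Require Import all_boot all_order all_algebra all_field.
From mathcomp Require Import boolp reals exp mpoly.
From mathcomp Require Import zify ring.
Import Order.TTheory GRing.Theory Num.Theory.
Local Open Scope ring_scope.

Set Implicit Arguments.
Unset Strict Implicit.
Unset Printing Implicit Defensive.

(* Let f_r be reduced modulo p, and let A_r be its truncation below degree p.
   Lucas' congruence gives f_r = A_r * f_r ^ p, so f_r ^ (p - 1) = 1 / A_r and
   f_r is a Kummer radical over K = F_p(x). Applying Frobenius to a K-linear
   combination of such radicals only rescales its terms; hence radicals that
   are pairwise not proportional over K are linearly independent, and K[F_s]
   contains every f_r. So the degree of F_s is at least the number of monomials
   \prod_r f_r ^ e_r that are pairwise not proportional over K.
   The exponents 0 <= e_r < m with m close to p ^ (1/2) all give such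
   monomials. Indeed, from \prod_r f_r ^ (e_r - e'_r) = u in K we get
   \prod_r A_r ^ (e'_r - e_r) = u ^ (p - 1). The hypergeometric equation of f_r
   bounds the multiplicities of the roots of A_r by r, so that zeros and poles
   of the left-hand side have order less than p - 1, and u is a constant. The
   logarithmic derivatives of the f_r then satisfy a nontrivial linear relation
   over F_p, unless e = e'. Over Z they satisfy none, because the coefficients
   of f_r grow faster than those of any product of the series f_q with q < r;
   this passes to F_p for p large. *)

(** * Central multinomial coefficients *)

Definition mult_coef r m := ((r * m)`! %/ m`! ^ r)%N.

Section MultCoef.
Local Open Scope nat_scope.

Lemma mult_coef_fact r m : mult_coef r m * m`! ^ r = (r * m)`!.
Proof. exact/divnK/dvdn_expn_fact. Qed.

Lemma mult_coef_gt0 r m : 0 < mult_coef r m.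
Proof.
have := fact_gt0 (r * m); rewrite -mult_coef_fact.
by case: (mult_coef r m).
Qed.

Lemma mult_coef0 r : mult_coef r 0 = 1.
Proof. by rewrite /mult_coef muln0 fact0 exp1n. Qed.

Lemma mult_coefS r m : mult_coef r.+1 m = 'C(r.+1 * m, m) * mult_coef r m.
Proof.
apply/eqP; rewrite -(eqn_pmul2r (_ : 0 < m`! ^ r.+1)) ?expn_gt0 ?fact_gt0//.
rewrite mult_coef_fact expnS.
have -> : 'C(r.+1 * m, m) * mult_coef r m * (m`! * m`! ^ r)
  = 'C(r.+1 * m, m) * (m`! * (mult_coef r m * m`! ^ r)) by ring.
have le_m : m <= r.+1 * m by rewrite leq_pmull.
by rewrite mult_coef_fact -(bin_fact le_m) mulSn addKn.
Qed.

Lemma bin_mul_le a b i j : 'C(a, i) * 'C(b, j) <= 'C(a + b, i + j).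
Proof.
rewrite -binomial.Vandermonde.
have ij : i < (i + j).+1 by rewrite ltnS leq_addr.
by rewrite (bigD1 (Ordinal ij)) //= addKn leq_addr.
Qed.

(** Each binomial factor given by [mult_coefS] is supermultiplicative, by Vandermonde's identity. *)
Lemma mult_coef_mul_le r i j :
  mult_coef r i * mult_coef r j <= mult_coef r (i + j).
Proof.
elim: r => [|r IHr]; first by rewrite /mult_coef !mul0n !expn0.
by rewrite !mult_coefS mulnACA mulnDr; apply: leq_mul; rewrite ?bin_mul_le.
Qed.

Lemma bin_mull_ge k m : k ^ m <= 'C(k * m, m).
Proof.
elim: m => [|m IHm]; first by rewrite muln0 bin0.
rewrite expnS mulnS -(add1n m).
by apply: leq_trans (bin_mul_le _ _ _ _); rewrite bin1 leq_mul.
Qed.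

Lemma mult_coefS_ge r m : r.+1 ^ m * mult_coef r m <= mult_coef r.+1 m.
Proof. by rewrite mult_coefS leq_mul ?bin_mull_ge. Qed.

Lemma mult_coef_le r q m : r <= q -> mult_coef r m <= mult_coef q m.
Proof.
move=> /subnK <-; elim: (q - r) => // d IHd; apply: leq_trans IHd _.
by rewrite addSn; apply: leq_trans (mult_coefS_ge _ _); rewrite leq_pmull ?expn_gt0.
Qed.

Lemma fact_addn a b : (a + b)`! = a`! * \prod_(j < b) (a + j.+1).
Proof.
elim: b => [|b IHb]; first by rewrite addn0 big_ord0 muln1.
by rewrite big_ord_recr /= mulnA -IHb addnS factS mulnC.
Qed.

(** With [r = n.+1], the ratio of consecutive coefficients is
    [(r m + 1) ... (r m + r) / (m + 1) ^ r]. Its last factor [r (m + 1)] cancels one [m + 1], which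
    lowers the order of the differential equation to [n]. *)
Lemma mult_coef_rec n m :
  m.+1 ^ n * mult_coef n.+1 m.+1
  = n.+1 * (\prod_(j < n) (n.+1 * m + j.+1)) * mult_coef n.+1 m.
Proof.
apply/eqP; rewrite -(eqn_pmul2r (_ : 0 < m.+1 * m`! ^ n.+1)); last first.
  by rewrite muln_gt0 expn_gt0 fact_gt0.
have -> : m.+1 ^ n * mult_coef n.+1 m.+1 * (m.+1 * m`! ^ n.+1)
  = mult_coef n.+1 m.+1 * m.+1`! ^ n.+1.
  by rewrite factS expnMn [m.+1 ^ n.+1]expnS; ring.
rewrite mult_coef_fact mulnS addnC fact_addn big_ord_recr /= -mult_coef_fact.
by apply/eqP; ring.
Qed.

End MultCoef.

(** * Lucas' congruence for multinomial coefficients *)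

Section Lucas.
Local Open Scope nat_scope.
Variable p : nat.
Hypothesis pP : prime p.

(** The multiples of [p] up to [N * p + i] contribute [p ^ N] and the factorial of [N]. The other
    factors form [N] full blocks of nonzero residues and a partial block of length [i], collected in
    [U]. *)
Lemma fact_mulp_add N i : i < p -> exists2 U,
  (N * p + i)`! = p ^ N * N`! * U & U = (p.-1)`! ^ N * i`! %[mod p].
Proof.
have p0 := prime_gt0 pP.
elim: i => [|i IHi] ip.
  elim: N => [|N [U NU Umod]]; first by exists 1.
  exists (U * \prod_(j < p.-1) (N * p + j.+1)).
    rewrite addn0 in NU *.
    rewrite addn0 mulSn addnC fact_addn NU.
    have -> : \prod_(j < p) (N * p + j.+1)
        = \prod_(j < p.-1) (N * p + j.+1) * (N * p + p).
      move: (N * p) => c; case: {+}p p0 => // q _; exact: big_ord_recr.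
    by rewrite factS expnS -mulSnr; ring.
  rewrite muln1 -modnMm Umod modnMm muln1 expnSr -modnMmr -[RHS]modnMmr.
  congr ((_ * _) %% p).
  rewrite fact_prod big_add1 /= big_mkord.
  by elim/big_rec2: _ => // j y1 y2 _ IH; rewrite -modnMm IH modnMDl modnMm.
have [|U NU Umod] := IHi; first exact: ltnW.
exists (U * (N * p + i.+1)); first by rewrite addnS factS NU; ring.
by rewrite -modnMm Umod modnMDl modnMm factS mulnAC mulnA.
Qed.

Lemma coprime_fact i : i < p -> coprime p i`!.
Proof.
elim: i => [|i IHi] ip; first exact: coprimen1.
rewrite factS coprimeMr IHi 1?ltnW// andbT prime_coprime//.
by rewrite gtnNdvd.
Qed.

Lemma mult_coef_modp_eq0 r j : j < p -> p <= r * j -> p %| mult_coef r j.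
Proof.
move=> jp prj; have : p %| mult_coef r j * j`! ^ r.
  by rewrite mult_coef_fact dvdn_fact// prime_gt0.
by rewrite Gauss_dvdl// coprimeXr ?coprime_fact.
Qed.

Lemma modn_mulIr a b c : coprime p c -> a * c = b * c %[mod p] -> a = b %[mod p].
Proof.
move=> cp; wlog ba : a b / b <= a => [wl|/eqP].
  by case/orP: (leq_total a b) => [ab /esym|ba]; [move=> /wl ->|apply: wl].
by rewrite eqn_mod_dvd ?leq_mul// -mulnBl Gauss_dvdl// -eqn_mod_dvd// => /eqP.
Qed.

Lemma mult_coef_lucas r m j : j < p ->
  mult_coef r (m * p + j) = mult_coef r m * mult_coef r j %[mod p].
Proof.
move=> jp; have [U mjU Umod] := fact_mulp_add m jp.
have cpw : coprime p p.-1`! by rewrite coprime_fact// ltn_predL prime_gt0.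
have cU : coprime p (U ^ r).
  rewrite coprimeXr// -coprime_modr Umod coprime_modr coprimeMr.
  by apply/andP; split; [apply: coprimeXr | apply: coprime_fact].
have pm0 : 0 < (p ^ m * m`!) ^ r.
  by rewrite expn_gt0 muln_gt0 expn_gt0 prime_gt0 ?fact_gt0.
have := mult_coef_fact r (m * p + j); rewrite mjU expnMn mulnCA mulnA.
(* If [p <= r * j], the carry [q > 0] leaves an extra [p ^ q] in the numerator, so both sides vanish
   modulo [p]. *)
have [prj|rjp] := leqP p (r * j).
  set q := r * j %/ p; set i := r * j %% p.
  have -> : r * (m * p + j) = (r * m + q) * p + i.
    by rewrite mulnDr mulnA {1}[r * j](divn_eq _ p) mulnDl addnA.
  have [|V -> _] := @fact_mulp_add (r * m + q) i; first by rewrite ltn_mod prime_gt0.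
  have q0 : 0 < q by rewrite divn_gt0 ?prime_gt0.
  rewrite expnD fact_addn -mult_coef_fact.
  set P := \prod_(_ < _) _ => E.
  move: E; have -> : p ^ (r * m) = (p ^ m) ^ r by rewrite -expnM mulnC.
  have -> : (p ^ m) ^ r * p ^ q * (mult_coef r m * m`! ^ r * P) * V
    = (p ^ m * m`!) ^ r * (p ^ q * mult_coef r m * P * V) by rewrite expnMn; ring.
  rewrite -mulnA => /eqP; rewrite eqn_pmul2l// => /eqP EU.
  have : p %| mult_coef r (m * p + j) * U ^ r.
    by rewrite EU -!mulnA dvdn_mulr// -(prednK q0) expnS dvdn_mulr.
  rewrite Gauss_dvdl// => /eqP ->; apply/esym/eqP.
  by apply/dvdn_mull/mult_coef_modp_eq0.
(* Without a carry the powers of [p] cancel exactly, and what remains is compared up to a unit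
   modulo [p]. *)
have -> : r * (m * p + j) = (r * m) * p + r * j by rewrite mulnDr mulnA.
have [V -> Vmod] := @fact_mulp_add (r * m) (r * j) rjp.
rewrite -mult_coef_fact.
have -> : p ^ (r * m) = (p ^ m) ^ r by rewrite -expnM mulnC.
have -> : (p ^ m) ^ r * (mult_coef r m * m`! ^ r) * V
    = (p ^ m * m`!) ^ r * (mult_coef r m * V) by rewrite expnMn; ring.
rewrite -mulnA => /eqP; rewrite eqn_pmul2l// => /eqP EU.
apply: (@modn_mulIr _ _ ((p.-1`! ^ m * j`!) ^ r)).
  apply: coprimeXr; rewrite coprimeMr; apply/andP.
  by split; [apply: coprimeXr | apply: coprime_fact].
rewrite -modnMmr -modnXm -Umod modnXm modnMmr EU -modnMmr Vmod modnMmr.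
by rewrite -mult_coef_fact expnMn [r * m]mulnC expnM; congr (_ %% _); ring.
Qed.

End Lucas.

(** * Multiplicative independence in characteristic 0 *)

Section Euler.
Variable R : comNzRingType.
Implicit Types f g h : fps R.

Definition fps_euler f : fps R := FPS (fun n => f n *+ n).

Lemma fps_eulerM f g : fps_euler (f * g) = fps_euler f * g + f * fps_euler g.
Proof.
apply: fpsP => n; rewrite coef_fpsD !coef_fpsM /= -sumrMnl -big_split /=.
apply: eq_bigr => i _; rewrite mulrnAl mulrnAr -mulrnDr subnKC//.
by rewrite -ltnS.
Qed.

Lemma fps_euler1 : fps_euler 1 = 0.
Proof. by apply: fpsP => -[|n] /=; rewrite ?mulr0n ?mul0rn. Qed.

Variables (n : nat) (f : 'I_n -> fps R).

(* [log_num i / \prod_j f j] is the logarithmic derivative of [f i]. *)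
Definition log_num i : fps R := fps_euler (f i) * \prod_(j < n | j != i) f j.

(** Logarithmic derivatives turn products into sums; the factor [\prod_j f j] clears their
    denominators. *)
Lemma euler_prod_exp (e : 'I_n -> nat) :
  (\prod_j f j) * fps_euler (\prod_i f i ^+ e i)
  = (\sum_i log_num i *+ e i) * \prod_i f i ^+ e i.
Proof.
pose P g h := (\prod_j f j) * fps_euler g = h * g.
have P1 : P 1 0 by rewrite /P fps_euler1 mulr0 mul0r.
have PM g1 h1 g2 h2 : P g1 h1 -> P g2 h2 -> P (g1 * g2) (h1 + h2).
  rewrite /P fps_eulerM => E1 E2; rewrite mulrDr mulrA E1 mulrCA E2; ring.
apply: (big_rec2 (fun h g => P g h)) => // i h g _ Ph; apply: (PM) => //.
elim: (e i) => [|k IHk]; first by rewrite expr0 mulr0n.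
rewrite exprS mulrS; apply: (PM) => //.
by rewrite /P /log_num (bigD1 i) //= mulrC mulrA mulrAC.
Qed.

End Euler.

(** If [m] is the order of [F - G], the coefficients of degree [m] give [m = 0], whereas the
    constant terms agree. *)
Lemma fps_euler_int_eq (F G : fps int) : F 0%N = 1 -> G 0%N = 1 ->
  fps_euler F * G = F * fps_euler G -> F = G.
Proof.
move=> F0 G0 FG; apply/eqP; rewrite -subr_eq0; apply/negPn/negP.
case/fps_neq0_order=> m dm dmin.
have E : fps_euler (F - G) * G = (F - G) * fps_euler G.
  have -> : fps_euler (F - G) = fps_euler F - fps_euler G.
    by apply: fpsP => k /=; rewrite mulrnBl.
  by rewrite !mulrBl FG [fps_euler G * G]mulrC.
have := congr1 (fun h : fps int => h m) E; rewrite !coef_fpsM !big_ord_recr /=.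
rewrite !big1 => [|i _|i _];
  try by have := dmin i (ltn_ord i); rewrite coef_fpsD coef_fpsN => ->;
    rewrite ?mul0rn mul0r.
rewrite subnn G0 mulr1 mulr0n mulr0 !add0r => /eqP.
rewrite mulrn_eq0 (negPf dm) orbF => /eqP m0.
by move/eqP: dm; apply; rewrite m0 coef_fpsD coef_fpsN F0 G0 subrr.
Qed.

Lemma fpsX0 (R : comNzRingType) (f : fps R) k : f 0%N = 1 -> (f ^+ k) 0%N = 1.
Proof.
move=> f0; elim: k => // k IHk.
by rewrite exprS coef_fpsM big_ord_recl big_ord0 /= subn0 f0 IHk mulr1 addr0.
Qed.

Lemma fps_prod0 (R : comNzRingType) (I : finType) (f : I -> fps R) :
  (forall i, f i 0%N = 1) -> (\prod_i f i) 0%N = 1.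
Proof.
move=> f0; elim/big_ind: _ => // g h g0 h0.
by rewrite coef_fpsM big_ord_recl big_ord0 /= subn0 g0 h0 mulr1 addr0.
Qed.

Lemma exp_dominates_poly k : exists n, (n.+1 ^ k < 2 ^ n)%N.
Proof.
(* With [n + 1 = 2 ^ (2 * l)] the claim reads [2 * l * k < 2 ^ (2 * l) - 1]. As [2 * k = l - 1], it
   follows from [l < 2 ^ l]. *)
pose l := (k + k).+1; exists (2 ^ (l + l)).-1.
rewrite prednK ?expn_gt0// -expnM ltn_exp2l// expnD.
have := ltn_expl l (isT : 1 < 2)%N; rewrite /l; nia.
Qed.

(** * Growth of the coefficients of products *)

Section Growth.

(** The polynomial factor absorbs the number of terms in Cauchy products. *)
Definition fps_bounded q k (h : fps int) :=
  forall n, 0 <= h n <= (n.+1 ^ k * mult_coef q n)%N%:Z.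

Lemma fps_bounded1 q : fps_bounded q 0 1.
Proof.
by case=> [|n] /=; rewrite mul1n ?mult_coef0 //= lez_nat.
Qed.

Lemma fps_bounded_multinomial q r : (r <= q)%N -> fps_bounded q 0 (multinomial_fps r).
Proof. by move=> rq n; rewrite mul1n /= lez_nat mult_coef_le. Qed.

Lemma fps_boundedM q k l g h : fps_bounded q k g -> fps_bounded q l h ->
  fps_bounded q (k + l).+1 (g * h).
Proof.
move=> gk hl n; rewrite coef_fpsM; apply/andP; split.
  apply: sumr_ge0 => i _; case/andP: (gk i) => g0 _.
  by case/andP: (hl (n - i)%N) => h0 _; rewrite mulr_ge0.
have -> : (n.+1 ^ (k + l).+1 * mult_coef q n)%N%:Z
   = \sum_(i < n.+1) (n.+1 ^ (k + l) * mult_coef q n)%N%:Z.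
  by rewrite sumr_const card_ord expnS -mulnA -mulr_natl natz PoszM.
apply: ler_sum => i _; case/andP: (gk i) => g0 gi; case/andP: (hl (n - i)%N) => h0 hi.
apply: le_trans (ler_pM g0 h0 gi hi) _; rewrite -PoszM lez_nat mulnACA expnD.
have i_le : (i <= n)%N by rewrite -ltnS.
apply: leq_mul; last first.
  by have := mult_coef_mul_le q i (n - i); rewrite subnKC.
have mono a b c : (a <= b)%N -> (a ^ c <= b ^ c)%N by case: c => // c ab; rewrite leq_exp2r.
by apply: leq_mul; apply: mono; rewrite ltnS// leq_subr.
Qed.

Definition fps_nneg1 (h : fps int) := h 0%N = 1 /\ forall n, 0 <= h n.

Lemma fps_nneg1_1 : fps_nneg1 1.
Proof. by split=> // -[]. Qed.

Lemma fps_nneg1_multinomial r : fps_nneg1 (multinomial_fps r).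
Proof. by split=> [|n] //; rewrite /= muln0 fact0 exp1n. Qed.

Lemma fps_nneg1M g h : fps_nneg1 g -> fps_nneg1 h -> fps_nneg1 (g * h).
Proof.
move=> [g0 gn] [h0 hn]; split=> [|n].
  by rewrite coef_fpsM big_ord_recl big_ord0 /= subn0 g0 h0 mulr1 addr0.
by rewrite coef_fpsM sumr_ge0// => i _; rewrite mulr_ge0.
Qed.

Lemma fps_nneg1_prod (I : finType) (P : pred I) (r : I -> nat) (e : I -> nat) :
  fps_nneg1 (\prod_(i | P i) multinomial_fps (r i) ^+ e i).
Proof.
elim/big_ind: _ => [|g h|i _]; [exact: fps_nneg1_1 | exact: fps_nneg1M |].
elim: (e i) => [|k IHk]; first exact: fps_nneg1_1.
by rewrite exprS; apply: fps_nneg1M => //; exact: fps_nneg1_multinomial.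
Qed.

Lemma fps_bounded_prod q (I : finType) (r : I -> nat) (e : I -> nat) :
  (forall i, (q < r i)%N -> e i = 0%N) ->
  exists k, fps_bounded q k (\prod_i multinomial_fps (r i) ^+ e i).
Proof.
move=> e0; elim/big_ind: _ => [|g h [k gk] [l hl]|i _].
- by exists 0%N; exact: fps_bounded1.
- by exists (k + l).+1; exact: fps_boundedM.
have [/e0 ->|riq] := ltnP q (r i); first by exists 0%N; exact: fps_bounded1.
elim: (e i) => [|d [k IHk]]; first by exists 0%N; exact: fps_bounded1.
by exists (0 + k).+1; rewrite exprS; apply: fps_boundedM => //; exact: fps_bounded_multinomial.
Qed.

(* The coefficients of [multinomial_fps r.+1] grow faster by a factor
   [r.+1 ^ n] than those of [multinomial_fps r]. *)
Lemma multinomial_prod_neq (I : finType) (r : I -> nat) (e e' : I -> nat) j :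
  (1 < r j)%N -> e j != 0%N -> (forall i, (r j <= r i)%N -> e' i = 0%N) ->
  \prod_i multinomial_fps (r i) ^+ e i <> \prod_i multinomial_fps (r i) ^+ e' i.
Proof.
move=> rj1 ej e'0 E.
have [i ri|k e'k] := @fps_bounded_prod (r j).-1 I r e'.
  by apply: e'0; rewrite -(ltn_predK rj1).
have [n kn] := exp_dominates_poly k.
(* One factor [multinomial_fps (r j)] is split off. Its cofactor is nonnegative with constant term
   1, so the coefficient of degree [n] is at least [mult_coef (r j) n]. *)
have Ej : \prod_i multinomial_fps (r i) ^+ e i = multinomial_fps (r j)
    * (multinomial_fps (r j) ^+ (e j).-1
       * \prod_(i | i != j) multinomial_fps (r i) ^+ e i).
  by rewrite (bigD1 j)//= mulrA -exprS prednK ?lt0n.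
have /andP[_] := e'k n; rewrite -E Ej; set h := _ * \prod_(_ | _) _.
have [h0 hn] : fps_nneg1 h.
  apply: fps_nneg1M; last exact: fps_nneg1_prod.
  by have := fps_nneg1_prod (pred1 j) r (fun i => (e i).-1); rewrite big_pred1_eq.
move: h h0 hn => {Ej} h h0 hn; apply/negP; rewrite -ltNge coef_fpsM big_ord_recr /= subnn h0 mulr1.
apply: (@lt_le_trans _ _ (mult_coef (r j) n)%:Z); last first.
  by rewrite lerDr sumr_ge0// => i _; rewrite mulr_ge0.
rewrite ltz_nat -{2}(prednK (ltnW rj1)).
apply: leq_trans (mult_coefS_ge _ _); rewrite ltn_pmul2r ?mult_coef_gt0//.
rewrite (prednK (ltnW rj1)); apply: leq_trans kn _.
by case: n => // n; rewrite leq_exp2r.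
Qed.
End Growth.

(* The largest [r j] with [e j <> e' j] dominates, after division by the
   common factors. *)
Lemma multinomial_exp_inj (I : finType) (r : I -> nat) (e e' : I -> nat) :
  injective r -> (forall i, (1 < r i)%N) ->
  \prod_i multinomial_fps (r i) ^+ e i = \prod_i multinomial_fps (r i) ^+ e' i ->
  e =1 e'.
Proof.
move=> rI r1 E; apply/eqfunP; apply/negPn/negP; rewrite negb_forall.
case/existsP => i0 i0P; pose m i := minn (e i) (e' i).
have := @arg_maxnP _ i0 (fun i => e i != e' i) r i0P; case=> j ej jmax.
have f0 : \prod_i multinomial_fps (r i) ^+ m i != 0.
  apply/eqP => /(congr1 (fun h : fps int => h 0%N)); rewrite fps_prod0// => i.
  by rewrite fpsX0//= muln0 fact0 exp1n.
have {}E : \prod_i multinomial_fps (r i) ^+ (e i - m i)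
    = \prod_i multinomial_fps (r i) ^+ (e' i - m i).
  apply: (mulIf f0); rewrite -!big_split /=.
  under eq_bigr do rewrite -exprD subnK ?geq_minl//.
  by under [RHS]eq_bigr do rewrite -exprD subnK ?geq_minr//.
have eq_above i : (r j < r i)%N -> e i = e' i.
  by move=> ji; apply/eqP; apply: contraTT ji => /jmax; rewrite -leqNgt.
have [ejl|ejl|ejl] := ltngtP (e j) (e' j); last by rewrite ejl eqxx in ej.
  apply: (@multinomial_prod_neq I r _ _ j _ _ _ (esym E)) => [//| |i].
    by rewrite /m -lt0n subn_gt0 gtn_min ejl.
  rewrite leq_eqVlt => /orP[/eqP/rI <-|/eq_above]; rewrite /m; lia.
apply: (@multinomial_prod_neq I r _ _ j _ _ _ E) => [//| |i].
  by rewrite /m -lt0n subn_gt0 gtn_min ejl orbT.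
rewrite leq_eqVlt => /orP[/eqP/rI <-|/eq_above]; rewrite /m; lia.
Qed.

(** With [c = e - e'], a relation between logarithmic derivatives integrates to an equality between
    the monomials of exponents [e] and [e']. *)
Lemma log_num_independent n (r : 'I_n -> nat) (c : 'I_n -> int) :
  injective r -> (forall i, (1 < r i)%N) ->
  \sum_i log_num (fun i => multinomial_fps (r i)) i *~ c i = 0 -> c =1 fun=> 0.
Proof.
move=> rI r1 cH; pose f i := multinomial_fps (r i).
pose e i := if 0 <= c i then `|c i|%N else 0%N.
pose e' i := if 0 <= c i then 0%N else `|c i|%N.
have ce i : c i = (e i)%:Z - (e' i)%:Z.
  by rewrite /e /e'; case: ifP; lia.
have f0 i : f i 0%N = 1 by rewrite /f /= muln0 fact0 exp1n.
have nz (g : fps int) : g 0%N = 1 -> g != 0.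
  by move=> g0; apply/eqP => E; move: g0; rewrite E.
suff /(multinomial_exp_inj rI r1) ee' : \prod_i f i ^+ e i = \prod_i f i ^+ e' i.
  by move=> i; rewrite ce ee' subrr.
apply: fps_euler_int_eq; try by apply: fps_prod0 => i; rewrite fpsX0.
have He : \sum_i log_num f i *+ e i = \sum_i log_num f i *+ e' i.
  apply/eqP; rewrite -subr_eq0 -sumrB -[X in _ == X]cH; apply/eqP.
  by apply: eq_bigr => i _; rewrite ce mulrzBr -!pmulrn.
apply: (mulfI (nz _ (fps_prod0 f0))).
by rewrite mulrA euler_prod_exp [RHS]mulrCA euler_prod_exp He -mulrA mulrCA.
Qed.

(* [D] is the product of the pivots of a Gaussian elimination. *)
Lemma independent_modp n (H : 'I_n -> nat -> int) :
  (forall c : 'I_n -> int, (forall m, \sum_i H i m * c i = 0) -> c =1 fun=> 0) ->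
  exists2 D : int, D != 0 & forall p : nat, prime p -> ~~ (p %| D)%Z ->
    forall c : 'I_n -> int, (forall m, (p %| \sum_i H i m * c i)%Z) ->
    forall i, (p %| c i)%Z.
Proof.
elim: n H => [|n IHn] H indep; first by exists 1 => // p _ _ c _ [].
pose w := widen_ord (leqnSn n).
have [m Hm] : exists m, H ord_max m != 0.
  apply: contrapT => nex.
  have /(_ ord_max) : (fun i : 'I_n.+1 => (i == ord_max)%:R : int) =1 fun=> 0.
    apply: indep => m; apply: big1 => i _; case: eqP => [->|_]; last by rewrite mulr0.
    rewrite mulr1; apply/eqP; apply: contrapT => /negP Hm; apply: nex; exists m.
    exact: Hm.
  by rewrite eqxx.
(* The pivot [h] serves to clear column [m] from the other rows, without division. *)
set h := H ord_max m in Hm.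
pose H' i k := H (w i) k * h - H ord_max k * H (w i) m.
have sumE (c : 'I_n -> int) k : \sum_i H' i k * c i = (\sum_i H (w i) k * c i) * h
    - H ord_max k * (\sum_i H (w i) m * c i).
  rewrite mulr_suml mulr_sumr -sumrB; apply: eq_bigr => i _; rewrite /H'; ring.
have [c cH'|D D0 Dp] := IHn H'.
  (* A relation [c] between the rows of [H'] lifts to one between the rows of [H]; the last
     coefficient is the one that cancels column [m]. *)
  pose c' i := if unlift ord_max i is Some j then c j * h
               else - \sum_i H (w i) m * c i.
  have c'w i : c' (w i) = c i * h.
    rewrite /c'; have -> : w i = lift ord_max i by apply: val_inj; rewrite /= /bump leqNgt ltn_ord.
    by rewrite liftK.
  have c'0 : c' =1 fun=> 0.
    apply: indep => k; rewrite big_ord_recr /= -/w.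
    under eq_bigr do rewrite c'w mulrA.
    by rewrite -mulr_suml /c' unlift_none mulrN -sumE.
  move=> i; have := c'0 (w i); rewrite c'w => /eqP.
  by rewrite mulf_eq0 (negPf Hm) orbF => /eqP.
exists (D * h) => [|p pP]; first by rewrite mulf_neq0.
have pM a b : (p %| a * b)%Z = (p %| a)%Z || (p %| b)%Z.
  by rewrite !dvdzE abszM Euclid_dvdM.
rewrite pM negb_or => /andP[pD ph] c pc.
have pw i : (p %| c (w i))%Z.
  apply: (Dp p pP pD (fun i => c (w i))) => k; rewrite sumE.
  have := pc k; have := pc m; rewrite !big_ord_recr /= -/w -/h => pm pk.
  set A := \sum_(_ < _) _ in pk *; set B := \sum_(_ < _) _ in pm *.
  have -> : A * h - H ord_max k * B
    = (A + H ord_max k * c ord_max) * h - H ord_max k * (B + h * c ord_max) by ring.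
  by apply: rpredB; [apply: dvdz_mulr | apply: dvdz_mull].
move=> i; case: (unliftP ord_max i) => [j|] ->.
  by have := pw j; congr (_ %| c _)%Z; apply: val_inj; rewrite /= /bump leqNgt ltn_ord.
have := pc m; rewrite big_ord_recr /= -/w -/h => phc.
suff : (p %| h * c ord_max)%Z by rewrite pM (negPf ph).
have : (p %| \sum_(i < n) H (w i) m * c (w i))%Z.
  by apply: rpred_sum => k _; apply: dvdz_mull.
by move=> pB; have := rpredB phc pB; rewrite addrAC subrr add0r.
Qed.

(** * Kummer radicals and the degree of their sum *)

Section Radicals.
Variables (K M : fieldType) (iota : {rmorphism K -> M}) (p : nat).
Hypothesis pM : p \in [pchar M].
Hypothesis root1K : forall w : M, w ^+ p.-1 = 1 -> exists u, w = iota u.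

Let p_gt0 : (0 < p)%N. Proof. by rewrite prime_gt0// (pcharf_prime pM). Qed.

Let expr_pred (x : M) : x ^+ p = x * x ^+ p.-1.
Proof. by rewrite -exprS prednK. Qed.

(* With [z i = c i * w i] and [j] the head of [r], the Frobenius image of
   [\sum_i z i], minus [z j ^+ p.-1] times that sum, is a combination of the
   [w i], [i != j], whose coefficients vanish only with [c i], since
   [z i / z j] is not a root of unity of order [p.-1]. *)
Lemma radical_components (W : M -> Prop) (I : eqType) (r : seq I) (w : I -> M)
    (h c : I -> K) :
  (forall x y, W x -> W y -> W (x + y)) -> (forall u x, W x -> W (iota u * x)) ->
  (forall x, W x -> W (x ^+ p)) ->
  uniq r -> (forall i, w i != 0) -> (forall i, w i ^+ p.-1 = iota (h i)) ->
  (forall i j u, w i = iota u * w j -> i = j) ->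
  W (\sum_(i <- r) iota (c i) * w i) -> {in r, forall i, W (iota (c i) * w i)}.
Proof.
move=> WD WZ WF + w0 wh wI; elim: r c => // j r IHr c /= /andP[jr ur].
rewrite big_cons; set z := fun i => iota (c i) * w i.
move=> Wz'; have {Wz'}Wz : W (z j + \sum_(i <- r) z i) := Wz'.
have W0 : W 0 by have := WZ 0 _ Wz; rewrite rmorph0 mul0r.
have WB x y : W x -> W y -> W (x - y).
  by move=> Wx Wy; rewrite -mulN1r -(rmorphN1 iota); apply: WD => //; exact: WZ.
have [cj0|cj0] := eqVneq (c j) 0.
  have zj0 : z j = 0 by rewrite /z cj0 rmorph0 mul0r.
  move: Wz; rewrite zj0 add0r => /(IHr _ ur) Wr i; rewrite inE => /predU1P[->|]; last exact: Wr.
  by rewrite -/(z j) zj0.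
pose a i := c i ^+ p.-1 * h i.
have za i : z i ^+ p.-1 = iota (a i) by rewrite exprMn wh rmorphM rmorphXn.
have Wa : W (\sum_(i <- r) iota ((a i - a j) * c i) * w i).
  have -> : \sum_(i <- r) iota ((a i - a j) * c i) * w i
    = (z j + \sum_(i <- r) z i) ^+ p - iota (a j) * (z j + \sum_(i <- r) z i).
    rewrite -!(pFrobenius_autE pM) rmorphD rmorph_sum /= !pFrobenius_autE.
    rewrite expr_pred za mulrDr [z j * _]mulrC opprD addrACA subrr add0r mulr_sumr -sumrB.
    apply: eq_bigr => i _; rewrite pFrobenius_autE expr_pred za rmorphM rmorphB /z.
    by ring.
  by apply: WB; [exact: WF | exact: WZ].
have Wr : {in r, forall i, W (z i)}.
  move=> i ir; have := IHr _ ur Wa i ir.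
  have [ci0 _|ci0] := eqVneq (c i) 0; first by rewrite /z ci0 rmorph0 mul0r.
  have aij : a i - a j != 0.
    rewrite subr_eq0; apply/eqP => aij; have [|u zu] := @root1K (z i / z j).
      rewrite expr_div_n !za aij divff// fmorph_eq0 -(fmorph_eq0 iota) -za.
      by rewrite expf_neq0// mulf_neq0 ?fmorph_eq0.
    suff ij : i = j by rewrite ij (negPf jr) in ir.
    apply: (wI i j (u * c j / c i)).
    have zj0 : z j != 0 by rewrite mulf_neq0 ?fmorph_eq0.
    have ici0 : iota (c i) != 0 by rewrite fmorph_eq0.
    apply: (mulfI ici0); rewrite -/(z i) -[LHS](divfK zj0) zu /z !rmorphM fmorphV.
    by field.
  by move/(WZ (a i - a j)^-1); rewrite mulrA -rmorphM mulKf.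
have Wzj : W (z j).
  rewrite -[z j](addrK (\sum_(i <- r) z i)); apply: WB => //.
  by rewrite big_seq; elim/big_ind: _ => //; apply: WD.
by move=> i; rewrite inE => /predU1P[->|]; [exact: Wzj | exact: Wr].
Qed.

(** If [size P <= m ^ s], the remainders modulo [P] of polynomials representing the [m ^ s]
    monomials are linearly dependent, which contradicts the independence of these radicals. *)
Lemma degree_lower_bound s m (phi : 'I_s -> M) (h : 'I_s -> K) (P : {poly K}) :
  (1 < m)%N -> (forall i, phi i != 0) -> (forall i, phi i ^+ p.-1 = iota (h i)) ->
  (forall (e e' : {ffun 'I_s -> 'I_m}) u,
     \prod_i phi i ^+ e i = iota u * \prod_i phi i ^+ e' i -> e = e') ->
  P != 0 -> root (map_poly iota P) (\sum_i phi i) -> (m ^ s < size P)%N.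
Proof.
move=> m1 phi0 phih phiI P0; set F := \sum_i phi i => PF.
pose W x := exists Q : {poly K}, x = (map_poly iota Q).[F].
have WD x y : W x -> W y -> W (x + y).
  by move=> [Q ->] [Q' ->]; exists (Q + Q'); rewrite rmorphD hornerD.
have WM x y : W x -> W y -> W (x * y).
  by move=> [Q ->] [Q' ->]; exists (Q * Q'); rewrite rmorphM hornerM.
have WK u : W (iota u) by exists u%:P; rewrite map_polyC hornerC.
have W1 : W 1 by rewrite -(rmorph1 iota).
have WX x k : W x -> W (x ^+ k).
  by move=> Wx; elim: k => [|k IHk]; rewrite ?expr0// exprS; apply: WM.
have WZ u x : W x -> W (iota u * x) by apply: WM.
pose mon (e : {ffun 'I_s -> 'I_m}) := \prod_i phi i ^+ e i.
pose unit_exp (i : 'I_s) : {ffun 'I_s -> 'I_m} :=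
  [ffun j => if j == i then Ordinal m1 else Ordinal (ltnW m1)].
have mon_unit i : mon (unit_exp i) = phi i.
  rewrite /mon (bigD1 i) //= ffunE eqxx expr1 big1 ?mulr1// => j ji.
  by rewrite ffunE (negPf ji) expr0.
have Wphi i : W (phi i).
  (* With [W = K[F]], which is stable under Frobenius, each summand of [F] lies in [K[F]]. *)
  have := @radical_components W _ (index_enum 'I_s) phi h (fun=> 1).
  move=> /(_ WD WZ (fun x => @WX x p) (index_enum_uniq _) phi0 phih).
  move=> H; rewrite -[phi i]mul1r -(rmorph1 iota);
  apply: H => [j k u jk||]; last by rewrite mem_index_enum.
    have /ffunP /(_ j) : unit_exp j = unit_exp k.
      by apply: (phiI _ _ u); rewrite -!/(mon _) !mon_unit.
    by rewrite !ffunE eqxx; case: eqP => // _ /(congr1 val).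
  by exists 'X; rewrite map_polyX hornerX; apply: eq_bigr => j _; rewrite rmorph1 mul1r.
have mon0 e : mon e != 0 by apply/prodf_neq0 => i _; rewrite expf_neq0.
have monh e : mon e ^+ p.-1 = iota (\prod_i h i ^+ e i).
  rewrite -prodrXl rmorph_prod; apply: eq_bigr => i _.
  by rewrite rmorphXn -phih exprAC.
have /choice[Q monQ] : forall e, exists Q : {poly K}, mon e = (map_poly iota (Q %% P)).[F].
  move=> e; have [Q ->] : W (mon e) by rewrite /mon; elim/big_ind: _ => // *; apply: WX.
  exists Q; rewrite {1}(divp_eq Q P) rmorphD rmorphM hornerD hornerM.
  by rewrite (rootP PF) mulr0 add0r.
rewrite ltnNge; apply/negP => Pm.
pose N := #|{ffun 'I_s -> 'I_m}|.
(* Row [i] lists the coefficients of the remainder of one monomial. There are fewer columns than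
   rows, hence a relation between the rows. *)
pose A : 'M[K]_(N, (size P).-1) := \matrix_(i, j) (Q (enum_val i) %% P)`_j.
have : kermx A != 0.
  rewrite kermx_eq0 -row_leq_rank -ltnNge; apply: leq_ltn_trans (rank_leq_col A) _.
  by rewrite /N card_ffun !card_ord (leq_trans _ Pm)// ltn_predL size_poly_gt0.
case/rowV0Pn => v /sub_kermxP vA; case/rV0Pn => k vk.
have vmon : \sum_(e <- index_enum {ffun 'I_s -> 'I_m}) iota (v 0 (enum_rank e)) * mon e = 0.
  have R0 : \sum_e v 0 (enum_rank e) *: (Q e %% P) = 0.
    apply/polyP => j; rewrite coef_sum coef0.
    have [jP|Pj] := ltnP j (size P).-1; last first.
      apply: big1 => e _; rewrite coefZ nth_default ?mulr0//.
      by rewrite (leq_trans _ Pj)// -ltnS (ltn_predK (ltn_modpN0 (Q e) P0)) ltn_modpN0.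
    have /matrixP /(_ 0 (Ordinal jP)) := vA; rewrite !mxE => vAj.
    rewrite -[RHS]vAj (reindex (fun i : 'I_N => enum_val i)) /=; last first.
      by apply: onW_bij; exact: enum_val_bij.
    by apply: eq_bigr => i _; rewrite mxE enum_valK coefZ.
  transitivity (map_poly iota (\sum_e v 0 (enum_rank e) *: (Q e %% P))).[F]; last first.
    by rewrite R0 rmorph0 horner0.
  rewrite rmorph_sum horner_sum.
  by apply: eq_bigr => e _; rewrite /= map_polyZ hornerZ monQ.
(* With [W] reduced to 0, every term of the relation vanishes separately. *)
have : iota (v 0 (enum_rank (enum_val k))) * mon (enum_val k) = 0.
  apply: (@radical_components (fun x => x = 0) _ _ mon (fun e => \prod_i h i ^+ e i)
    (fun e => v 0 (enum_rank e)) _ _ _ (index_enum_uniq _) mon0 monh phiI vmon).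
  - by move=> x y -> ->; rewrite addr0.
  - by move=> u x ->; rewrite mulr0.
  - by move=> x ->; rewrite expr0n gtn_eqF.
  - by rewrite mem_index_enum.
move=> /eqP; rewrite mulf_eq0 (negPf (mon0 _)) orbF fmorph_eq0 enum_valK.
by rewrite (negPf vk).
Qed.
End Radicals.

Lemma minimal_polynomial_ex (K M : fieldType) (iota : {rmorphism K -> M}) (x : M) :
  algebraicOver iota x -> exists P : {poly K}, [/\ P \is monic, root (map_poly iota P) x
    & forall Q, Q != 0 -> root (map_poly iota Q) x -> (size P <= size Q)%N].
Proof.
move=> [Q Q0 Qx].
pose size_of n := `[< exists Q : {poly K}, [/\ Q != 0, root (map_poly iota Q) x & size Q = n] >].
have exn : exists n, size_of n by exists (size Q); apply/asboolP; exists Q.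
case: (ex_minnP exn) => n /asboolP[P [P0 Px Pn]] nmin.
exists ((lead_coef P)^-1 *: P); split=> [||R R0 Rx].
- by rewrite monicE lead_coefZ mulVf ?lead_coef_eq0.
- by rewrite map_polyZ rootE hornerZ (rootP Px) mulr0.
- rewrite size_scale ?invr_eq0 ?lead_coef_eq0// Pn nmin//.
  by apply/asboolP; exists R.
Qed.

(** * Multiplicities of the roots of the truncated series *)

Section EulerPoly.
Variable E : fieldType.
Implicit Types Q A B C : {poly E}.

(* [Q (x d/dx)] applied to [A]: [x d/dx] multiplies the coefficient [A`_i] by [i]. *)
Definition euler_op Q A := \poly_(i < size A) (Q.[i%:R] * A`_i).

Lemma coef_euler_op Q A i : (euler_op Q A)`_i = Q.[i%:R] * A`_i.
Proof.
rewrite coef_poly; case: ltnP => // Ai.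
by rewrite nth_default ?mulr0.
Qed.

Lemma euler_opMXaddC Q c A :
  euler_op (Q * 'X + c%:P) A = 'X * (euler_op Q A)^`() + c%:P * A.
Proof.
apply/polyP => -[|i]; rewrite coefD coefXM !coefCM !coef_euler_op hornerMXaddC /=.
  by rewrite mulr0 !add0r.
by rewrite coef_deriv coef_euler_op -mulr_natr; ring.
Qed.

(** Each derivative lowers the order of vanishing at [a] by at most one, so only the coefficient of
    degree [d] of [Q] contributes at order [mu - d]. Differentiating [('X - a%:P) ^+ mu] [d] times
    produces the falling factorial. *)
Lemma euler_op_XsubCX a Q d mu B : (size Q <= d.+1)%N -> (d <= mu)%N ->
  exists C, euler_op Q (('X - a%:P) ^+ mu * B)
    = (Q`_d * (mu ^_ d)%:R)%:P * ('X^d * ('X - a%:P) ^+ (mu - d) * B)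
      + ('X - a%:P) ^+ (mu - d).+1 * C.
Proof.
set t : {poly E} := 'X - _; elim: d Q => [|d IHd] Q sQ dmu.
  exists 0; rewrite (size1_polyC sQ) coefC /= ffactn0 mulr1 expr0 mul1r subn0.
  rewrite mulr0 addr0; apply/polyP => i.
  by rewrite coef_euler_op hornerC coefCM.
elim/poly_ind: Q sQ => [_|Q c _ sQ].
  exists 0; rewrite coef0 mul0r polyC0 mul0r mulr0 addr0.
  by apply/polyP => i; rewrite coef_euler_op horner0 mul0r coef0.
have {}sQ : (size Q <= d.+1)%N.
  by move: sQ; rewrite size_MXaddC; case: ifP => // /andP[/eqP -> _]; rewrite size_poly0.
have [C EC] := IHd Q sQ (ltnW dmu).
rewrite euler_opMXaddC EC coefD coefMX coefC /= addr0 ffactnSr.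
have [j [-> ->]] : exists j, (mu - d = j.+1)%N /\ (mu = j.+1 + d)%N.
  by exists (mu - d.+1)%N; lia.
rewrite addSn subSS addnK; set k := Q`_d.
set l := (_ ^_ d); rewrite natrM mulrA.
exists ((k * l%:R)%:P * ('X * 'X^d^`() * B + 'X * 'X^d * B^`())
  + j.+2%:R * 'X * C + t * 'X * C^`() + c%:P * t ^+ d * B).
have dtX i : (t ^+ i.+1)^`() = i.+1%:R * t ^+ i.
  by rewrite deriv_exp derivXsubC mul1r mulr_natl.
have := dtX j.+1; have := dtX j; rewrite (exprD t j.+1 d) (exprS 'X d).
have := exprS t j; have := exprS t j.+1; move: (t ^+ d) 'X^d.
move: (t ^+ j) (t ^+ j.+1) (t ^+ j.+2) => u v w D X wv vu dv dw.
rewrite derivD !derivM dv dw derivC wv vu !polyCM !polyC_natr.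
ring.
Qed.

(** The second coefficient is tracked because the leading terms cancel in [trunc_mult_ode]. *)
Lemma prod_linear_coef (a : E) (b : nat -> E) n :
  exists2 Z : {poly E}, (size Z <= n)%N & \prod_(j < n.+1) (a%:P * 'X + (b j)%:P)
   = (a ^+ n.+1)%:P * 'X^(n.+1) + (a ^+ n * (\sum_(j < n.+1) b j))%:P * 'X^n + Z.
Proof.
elim: n => [|n [Z sZ EZ]].
  by exists 0; rewrite ?size_poly0// !big_ord1 expr1 expr0 mulr1 mul1r addr0.
exists ((a ^+ n * (\sum_(j < n.+1) b j) * b n.+1)%:P * 'X^n
    + Z * (a%:P * 'X + (b n.+1)%:P)).
  apply: leq_trans (size_polyD _ _) _; rewrite geq_max; apply/andP; split.
    by rewrite mul_polyC (leq_trans (size_scale_leq _ _))// size_polyXn.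
  apply: leq_trans (size_polyMleq _ _) _.
  have : (size (a%:P * 'X + (b n.+1)%:P)%R <= 2)%N.
    by rewrite size_MXaddC; case: ifP => // _; rewrite ltnS size_polyC leq_b1.
  by move: sZ; lia.
rewrite big_ord_recr /= EZ [in RHS]big_ord_recr /=; move: (\sum_(j < n.+1) b j) => S.
rewrite (exprS a n.+1) (exprS a n) (exprS 'X n.+1) (exprS 'X n) !(polyCM, polyCD).
ring.
Qed.

End EulerPoly.

Section Multiplicity.
Variables (E : fieldType) (p n : nat).
Hypotheses (pE : p \in [pchar E]) (n_gt1 : (1 < n)%N) (np : (n.+1 < p)%N).

Let pP : prime p. Proof. exact: pcharf_prime pE. Qed.

Definition trunc_mult r : {poly E} := \poly_(m < p) (mult_coef r m)%:R.

Local Notation r := n.+1.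
Local Notation A := (trunc_mult r).

Let natr_neq0 k : (0 < k < p)%N -> k%:R != 0 :> E.
Proof. by case/andP=> k0 kp; rewrite -(dvdn_pcharf pE) gtnNdvd. Qed.

Lemma coef_trunc_mult_eq0 m : (p <= r * m)%N -> A`_m = 0.
Proof.
move=> prm; rewrite coef_poly; case: ltnP => // mp.
by apply/eqP; rewrite -(dvdn_pcharf pE) mult_coef_modp_eq0.
Qed.

Lemma trunc_mult0 : A`_0 = 1.
Proof. by rewrite coef_poly prime_gt0// mult_coef0. Qed.

Lemma trunc_mult_neq0 : A != 0.
Proof. by apply: contra_eq_neq trunc_mult0 => ->; rewrite coef0 eq_sym oner_neq0. Qed.

(** This bound keeps the positive integers met in [trunc_mult_mup] below [p], hence nonzero in
    [E]. *)
Lemma trunc_mult_size m : (m < size A)%N -> (r * m < p)%N.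
Proof.
move=> mA; apply: leq_ltn_trans (_ : r * (size A).-1 < p)%N.
  by rewrite leq_mul// -ltnS (ltn_predK mA).
rewrite ltnNge; apply/negP => /coef_trunc_mult_eq0 /eqP.
by rewrite -/(lead_coef A) lead_coef_eq0 (negPf trunc_mult_neq0).
Qed.

(** The recurrence survives truncation: once [m + 1 >= p], both coefficients vanish. *)
Lemma trunc_mult_rec m : m.+1%:R ^+ n * A`_m.+1
  = r%:R * (\prod_(j < n) (r%:R * m%:R + j.+1%:R)) * A`_m.
Proof.
have [mp|pm] := ltnP m.+1 p.
  rewrite !coef_poly mp (ltnW mp) -natrX -natrM mult_coef_rec !natrM natr_prod.
  by congr (_ * _ * _); apply: eq_bigr => j _; rewrite natrD natrM.
rewrite !coef_trunc_mult_eq0 ?mulr0//; last by nia.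
have := prime_gt1 pP; nia.
Qed.

(** With [theta = x d/dx], the recurrence reads [theta ^ n A = x r \prod_(j < n) (r theta + j + 1)
    A]. The terms in [theta ^ n] are moved to the left; the sum [1 + ... + n] gives the next
    coefficient, doubled to avoid a division. *)
Lemma trunc_mult_ode : exists2 Q : {poly E},
    (size Q <= n)%N /\ 2%:R * Q`_n.-1 = n%:R * r%:R ^+ r
  & (1 - (r%:R ^+ r)%:P * 'X) * euler_op 'X^n A = 'X * euler_op Q A.
Proof.
pose P : {poly E} := \prod_(j < n) (r%:R%:P * 'X + j.+1%:R%:P).
have [m nm] : exists m, n = m.+1 by exists n.-1; rewrite (ltn_predK n_gt1).
have [Z sZ PZ] := prod_linear_coef r%:R (fun j => j.+1%:R : E) m.
rewrite -nm in sZ PZ.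
exists (r%:R%:P * P - (r%:R ^+ r)%:P * 'X^n).
  have -> : r%:R%:P * P - (r%:R ^+ r)%:P * 'X^n =
      (r%:R ^+ n * \sum_(j < n) j.+1%:R)%:P * 'X^m + r%:R%:P * Z.
    have rn (x : E) : x ^+ n = x * x ^+ m by rewrite nm exprS.
    by rewrite /P PZ (exprS _ n) rn !polyCM; ring.
  split.
    apply: leq_trans (size_polyD _ _) _; rewrite geq_max !mul_polyC; apply/andP; split.
      by rewrite (leq_trans (size_scale_leq _ _))// size_polyXn nm.
    by rewrite (leq_trans (size_scale_leq _ _))// (leq_trans sZ)// nm.
  rewrite nm /= coefD !coefCM coefXn eqxx mulr1 (nth_default 0 sZ) mulr0 addr0 -nm.
  rewrite mulrCA -natr_sum -natrM.
  have -> : (2 * \sum_(j < n) j.+1 = n * r)%N.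
    elim: (n) => [|k IHk]; first by rewrite big_ord0.
    by rewrite big_ord_recr /= mulnDr IHk; lia.
  by rewrite natrM exprS; ring.
apply/polyP => -[|i]; rewrite mulrBl mul1r coefB coefXM -mulrA coefCM coefXM !coef_euler_op /=.
  by rewrite hornerXn expr0n gtn_eqF ?(ltnW n_gt1)// !mul0r mulr0 subr0.
rewrite !hornerXn trunc_mult_rec hornerD hornerN !hornerM !hornerC hornerXn horner_prod.
under [in RHS]eq_bigr do rewrite !hornerE.
ring.
Qed.

(* The local exponents of the equation at a point [a] with [a != 0] are
   [0, ..., n - 1] if [r ^ r * a != 1], and [0, ..., n - 2, n / 2 - 1] if
   [r ^ r * a = 1]. *)
Lemma trunc_mult_mup a : (mup a A < n)%N.
Proof.
rewrite ltnNge; apply/negP => mun.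
have [Q [sQ Q2] ode] := trunc_mult_ode.
have [mu [B]] := multiplicity_XsubC A a; rewrite trunc_mult_neq0 /= => rB AB.
have muE : mup a A = mu.
  by rewrite AB mupMr// mup_XsubCX eqxx.
rewrite muE in mun.
have rmu : (r * mu < p)%N.
  have B0 : B != 0 by apply: contraNneq rB => ->; rewrite root0.
  apply: trunc_mult_size; rewrite AB size_Mmonic ?monic_exp ?monicXsubC//.
  by rewrite size_exp_XsubC addnS /= -[X in (X < _)%N]add0n ltn_add2r size_poly_gt0.
have a0 : a != 0.
  apply/eqP => a0; have := trunc_mult0;
  rewrite AB -horner_coef0 a0 hornerM horner_exp hornerXsubC subrr expr0n.
  by rewrite gtn_eqF ?mulr0 => [/eqP|]; rewrite ?(eq_sym 0) ?oner_eq0//; lia.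
have Ba : B.[a] != 0 by [].
have [C1 E1] := @euler_op_XsubCX E a 'X^n n mu B (eq_leq (size_polyXn _ _)) mun.
have sQ' : (size Q <= n.-1.+1)%N by rewrite (ltn_predK n_gt1).
have [C2 E2] := @euler_op_XsubCX E a Q n.-1 mu B sQ' (leq_trans (leq_pred _) mun).
move: ode; rewrite AB [B * _]mulrC E1 E2 coefXn eqxx mul1r => {E1 E2}.
have [j mj] : exists j, mu = (j + n)%N by exists (mu - n)%N; rewrite subnK.
have -> : (mu - n.-1 = j.+1)%N by move: (n_gt1); lia.
have -> : (mu - n = j)%N by rewrite mj addnK.
set t := 'X - a%:P; set R := r%:R ^+ r in Q2 *.
have t0 : t != 0 by rewrite polyXsubC_eq0.
have [m nm] : exists m, n = m.+1 by exists n.-1; rewrite (ltn_predK n_gt1).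
have -> : mu ^_ n = (mu ^_ n.-1 * j.+1)%N.
  by rewrite {1}nm ffactnSr nm /=; congr (_ * _)%N; lia.
set f := mu ^_ n.-1; set q := Q`_n.-1 in Q2 *.
have f0 : f%:R != 0 :> E.
  have : (f %| mu`!)%N by rewrite -(ffact_fact (leq_trans (leq_pred n) mun)) dvdn_mulr.
  rewrite -(dvdn_pcharf pE); apply: contraL => pf; apply/negP => /(dvdn_trans pf).
  have mup : (mu < p)%N by move: rmu; nia.
  by have := coprime_fact pP mup; rewrite prime_coprime// => /negPf ->.
move=> ode.
have {}ode : (1 - R%:P * 'X) * ((f * j.+1)%:R%:P * 'X^n * B + t * C1)
    = 'X * ((q * f%:R)%:P * 'X^(n.-1) * B + t * C2) * t.
  apply: (mulfI (expf_neq0 j t0)); move: ode; rewrite (exprS t j.+1) (exprS t j) => ode.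
  rewrite mulrCA; transitivity ((1 - R%:P * 'X)
    * ((f * j.+1)%:R%:P * ('X^n * t ^+ j * B) + t * t ^+ j * C1)); first by ring.
  by rewrite ode; ring.
(* The right-hand side vanishes at [a], which forces [a] to be the singular point [1 / R]. *)
have Ra : R * a = 1.
  have /eqP := congr1 (fun P => P.[a]) ode.
  rewrite /t !hornerE subrr !mul0r !mulr0 addr0 !mulf_eq0 (negPf Ba) natrM.
  rewrite !mulf_eq0 (negPf f0) expf_eq0 (negPf a0) andbF !orbF.
  rewrite orFb => /orP[/eqP/subr0_eq -> //|].
  by rewrite (negPf (natr_neq0 _))//; move: rmu (n_gt1); nia.
(* There [1 - R%:P * 'X] is a multiple of [t]. Dividing by [t] and evaluating at [a] again gives
   [- R * (j + 1) = q], where [2 q = n R]. *)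
have tR : 1 - R%:P * 'X = - R%:P * t by rewrite -polyC1 -Ra polyCM /t; ring.
have R0 : R != 0 by apply: contra_eq_neq Ra => ->; rewrite mul0r eq_sym oner_neq0.
have {}ode : - R%:P * ((f * j.+1)%:R%:P * 'X^n * B + t * C1)
    = 'X * ((q * f%:R)%:P * 'X^(n.-1) * B + t * C2).
  by apply: (mulIf t0); rewrite -ode tR; ring.
have := congr1 (fun P => P.[a]) ode.
rewrite /t !hornerE subrr !mul0r !addr0 nm /= => ode_a.
have {}ode_a : - R * j.+1%:R = q.
  apply: (mulIf f0); apply: (mulIf (expf_neq0 m.+1 a0)); apply: (mulIf Ba).
  move: ode_a; rewrite natrM exprS => ode_a.
  transitivity (- R * (f%:R * j.+1%:R * (a * a ^+ m) * B.[a])); first by ring.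
  by rewrite ode_a; ring.
(* The integer [2 (j + 1) + n] lies strictly between 0 and [p], because [r * mu < p]. *)
have /eqP : R * (2 * j.+1 + n)%:R = 0.
  by rewrite natrD natrM mulrDr [R * n%:R]mulrC -Q2 -ode_a; ring.
rewrite mulf_eq0 (negPf R0) /= (negPf (natr_neq0 _))//.
by move: rmu (n_gt1); nia.
Qed.

End Multiplicity.

(** * Reduction modulo p *)

Section ReductionModp.
Variable p : nat.
Hypothesis pP : prime p.

Lemma fps_mod_is_zmod_morphism : zmod_morphism (fps_mod p).
Proof. by move=> f g; apply: fpsP => n /=; rewrite rmorphB. Qed.

Lemma fps_mod_is_monoid_morphism : monoid_morphism (fps_mod p).
Proof.
split=> [|f g]; apply: fpsP => n; first by rewrite /=; case: (n == 0)%N.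
by rewrite coef_fpsM /= rmorph_sum; apply: eq_bigr => i _; rewrite rmorphM.
Qed.

HB.instance Definition _ :=
  GRing.isZmodMorphism.Build (fps int) (fps 'F_p) (fps_mod p) fps_mod_is_zmod_morphism.
HB.instance Definition _ :=
  GRing.isMonoidMorphism.Build (fps int) (fps 'F_p) (fps_mod p) fps_mod_is_monoid_morphism.

Lemma fps_mod_multinomial r n :
  fps_mod p (multinomial_fps r) n = (mult_coef r n)%:R.
Proof. by []. Qed.

Lemma pchar_fps : p \in [pchar fps 'F_p].
Proof.
apply: (rmorph_pchar (poly_fps (R := 'F_p))); rewrite pchar_poly.
exact: pchar_Fp.
Qed.

(** Write [f] as a truncation plus a tail of order above [n]. Frobenius is additive, and the [p]-th
    power of the tail has no term of degree [n]. *)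
Lemma coef_fps_expp (f : fps 'F_p) n :
  (f ^+ p) n = if (p %| n)%N then f (n %/ p)%N else 0.
Proof.
have p0 := prime_gt0 pP.
pose P := fps_trunc n.+1 f; pose t := f - poly_fps P.
have t0 i : (i <= n)%N -> t i = 0.
  by move=> i_n; rewrite coef_fpsD coef_fpsN /= coef_poly ltnS i_n subrr.
have -> : f ^+ p = poly_fps P ^+ p + t ^+ p.
  by rewrite -!(pFrobenius_autE pchar_fps) -rmorphD /t addrC subrK.
have tp : t ^+ p = t * t ^+ p.-1 by rewrite -exprS prednK.
rewrite coef_fpsD tp coef_fpsM big1 ?addr0; last first.
  by move=> i _; rewrite t0 ?mul0r// -ltnS.
have -> : poly_fps P ^+ p = poly_fps (\sum_(i < n.+1) f i *: 'X^(i * p)).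
  have pX : p \in [pchar {poly 'F_p}] by rewrite pchar_poly pchar_Fp.
  rewrite -rmorphXn; congr poly_fps; rewrite /P /fps_trunc poly_def.
  rewrite -(pFrobenius_autE pX) rmorph_sum; apply: eq_bigr => i _.
  rewrite /= pFrobenius_autE exprZn -exprM; congr (_ *: _).
  by have := expf_card (f i); rewrite card_Fp.
rewrite /= coef_sum; case: ifP => pn.
  have np : (n %/ p < n.+1)%N by rewrite ltnS leq_div.
  rewrite (bigD1 (Ordinal np)) //= coefZ coefXn divnK// eqxx mulr1 big1 ?addr0// => i.
  rewrite -val_eqE /= => inp; rewrite coefZ coefXn.
  case: eqP => [np'|_]; rewrite ?mulr0//.
  by case/eqP: inp; rewrite -(mulnK i p0) -np'.
rewrite big1// => i _; rewrite coefZ coefXn.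
case: eqP => [ni|_]; last by rewrite mulr0.
by case/negP: (negbT pn); rewrite ni dvdn_mull.
Qed.

Local Notation fm r := (fps_mod p (multinomial_fps r)).
Local Notation A r := (trunc_mult 'F_p p r).

(* Lucas' congruence says that [fm r = A r * fm r ^+ p]. *)
Lemma multinomial_kummer r : fm r ^+ p.-1 * poly_fps (A r) = 1.
Proof.
have p0 := prime_gt0 pP.
have f0 : fm r != 0.
  apply/eqP => /(congr1 (fun f : fps 'F_p => f 0%N)) /eqP.
  by rewrite fps_mod_multinomial mult_coef0 oner_eq0.
apply: (mulfI f0); rewrite mulrA -exprS prednK// mulr1 mulrC.
apply: fpsP => n; rewrite coef_fpsM.
(* Only the index [n %% p] contributes: [A r] has degree below [p], and [fm r ^+ p] is supported on
   multiples of [p]. *)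
have npn : (n %% p < n.+1)%N by rewrite ltnS leq_mod.
rewrite (bigD1 (Ordinal npn)) //= big1 => [|i].
  rewrite addr0 coef_poly ltn_mod p0 coef_fps_expp.
  have -> : (n - n %% p = n %/ p * p)%N by rewrite {1}(divn_eq n p) addnK.
  rewrite dvdn_mull// mulnK// fps_mod_multinomial -natrM mulnC.
  have := mult_coef_lucas pP r (n %/ p) (ltn_pmod n p0); rewrite -divn_eq => E.
  by rewrite -[LHS](Fp_nat_mod pP) -E (Fp_nat_mod pP).
rewrite -val_eqE /= => inp; rewrite coef_poly; case: ltnP => ip; last by rewrite mul0r.
rewrite coef_fps_expp; case: ifP; rewrite ?mulr0// => pni.
case/eqP: inp; have i_n : (i <= n)%N by rewrite -ltnS.
by rewrite -[RHS](congr1 (modn^~ p) (subnK i_n)) /= -modnDml (eqP pni) add0n modn_small.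
Qed.

End ReductionModp.

Lemma ratfun_laurent_tofrac (F : fieldType) (q : {poly F}) :
  ratfun_laurent (tofrac q) = tofrac (poly_fps q).
Proof.
by rewrite -[tofrac q]divr1 -tofrac1 ratfun_laurent_frac ?oner_neq0// rmorph1 tofrac1 divr1.
Qed.

Lemma frac_coprime (F : fieldType) (u : {fraction {poly F}}) :
  exists a b : {poly F}, [/\ coprimep a b, b != 0 & u = tofrac a / tofrac b].
Proof.
rewrite (frac_repr u); set n := \n_(repr u); set d := \d_(repr u).
have d0 : d != 0 by apply: denom_ratioP.
pose g := gcdp n d; exists (n %/ g), (d %/ g).
have ng : n %/ g * g = n by rewrite divpK ?dvdp_gcdl.
have dg : d %/ g * g = d by rewrite divpK ?dvdp_gcdr.
have /norP[dg0 g0] : ~~ ((d %/ g == 0) || (g == 0)) by rewrite -mulf_eq0 dg.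
split=> //; first by rewrite coprimep_div_gcd// d0 orbT.
by rewrite -{1}ng -{1}dg !tofracM -mulf_div divff ?tofrac_eq0// mulr1.
Qed.

Lemma mup_prod_exp (F : fieldType) (I : finType) (q : I -> {poly F}) (e : I -> nat) x :
  (forall i, q i != 0) ->
  mup x (\prod_i q i ^+ e i) = (\sum_i e i * mup x (q i))%N.
Proof.
move=> q0; have mupX i k : mup x (q i ^+ k) = (k * mup x (q i))%N.
  elim: k => [|k IHk]; first by rewrite expr0 mupNroot// root1.
  by rewrite exprS mupM ?expf_neq0// IHk.
pose P (g : {poly F}) m := g != 0 /\ mup x g = m.
suff [] : P (\prod_i q i ^+ e i) (\sum_i e i * mup x (q i))%N by [].
elim/big_rec2: _ => [|i m g _ [g0 <-]].
  by split; [exact: oner_neq0 | rewrite mupNroot// root1].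
by split; rewrite ?mulf_neq0 ?expf_neq0// mupM ?expf_neq0// mupX.
Qed.

(** A root of [b] in [E] is not a root of [a]. Its multiplicity is at least [N] on the left, but on
    the right it comes from [V] alone and is less than [N]. *)
Lemma coprime_expr_const (F : fieldType) (E : closedFieldType) (f : {rmorphism F -> E})
    (a b U V : {poly F}) N :
  coprimep a b -> a != 0 -> b != 0 -> U != 0 -> V != 0 ->
  (forall x, mup x (map_poly f V) < N)%N ->
  b ^+ N * U = a ^+ N * V -> size b = 1%N.
Proof.
move=> ab a0 b0 U0 V0 VN E1; apply/eqP; rewrite -(size_map_poly f).
apply/negPn/negP; case/closed_rootP => x bx.
have ax : ~~ root (map_poly f a) x.
  apply: (coprimep_root _ bx); by rewrite coprimep_map coprimep_sym.
have := VN x; rewrite ltnNge => /negP; apply.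
have fa0 : map_poly f a != 0 by rewrite map_poly_eq0.
have fb0 : map_poly f b != 0 by rewrite map_poly_eq0.
have fU0 : map_poly f U != 0 by rewrite map_poly_eq0.
have := congr1 (map_poly f) E1; rewrite !rmorphM !rmorphXn /= => /(congr1 (mup x)).
rewrite [RHS]mupMr => [<-|]; last first.
  apply: contra ax; rewrite /root horner_exp expf_eq0 => /andP[//].
rewrite mupM ?expf_neq0//; apply: leq_trans (leq_addr _ _).
rewrite mup_geq ?expf_neq0// dvdp_exp2r//.
by rewrite dvdp_XsubCl.
Qed.

Lemma map_trunc_mult (F E : fieldType) (f : {rmorphism F -> E}) p r :
  map_poly f (trunc_mult F p r) = trunc_mult E p r.
Proof.
apply/polyP => i; rewrite coef_map !coef_poly /=; case: (i < p)%N; first exact: rmorph_nat.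
exact: rmorph0.
Qed.

(** * Proportional monomials in the reduced series *)

Section MonomialRelations.
Variables (p s : nat) (r : 'I_s -> nat).
Hypotheses (pP : prime p) (r_bound : forall i, (2 < r i < p)%N).

Local Notation fm i := (fps_mod p (multinomial_fps (r i))).
Local Notation A i := (trunc_mult 'F_p p (r i)).

Lemma fps_mod_multinomial_neq0 i : fm i != 0.
Proof.
apply/eqP => /(congr1 (fun f : fps 'F_p => f 0%N)) /eqP.
by rewrite fps_mod_multinomial mult_coef0 oner_eq0.
Qed.

Lemma kummer_prod (e : 'I_s -> nat) :
  (\prod_i fm i ^+ e i) ^+ p.-1 * poly_fps (\prod_i A i ^+ e i) = 1.
Proof.
rewrite -prodrXl rmorph_prod -big_split big1//= => i _.
by rewrite rmorphXn exprAC -exprMn multinomial_kummer// expr1n.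
Qed.

Lemma trunc_mult_pneq0 (E : fieldType) i : p \in [pchar E] -> trunc_mult E p (r i) != 0.
Proof.
move=> pE; case/andP: (r_bound i) => r2 rp.
rewrite -(ltn_predK r2); apply: trunc_mult_neq0 => //.
Qed.

Lemma monomial_relation_const (e e' : 'I_s -> nat) u :
  (\sum_i e i * r i < p.-1)%N -> (\sum_i e' i * r i < p.-1)%N ->
  \prod_i tofrac (fm i) ^+ e i = ratfun_laurent u * \prod_i tofrac (fm i) ^+ e' i ->
  exists2 c : 'F_p * 'F_p, c.1 != 0 /\ c.2 != 0
    & poly_fps c.1%:P * \prod_i fm i ^+ e i = poly_fps c.2%:P * \prod_i fm i ^+ e' i.
Proof.
move=> er e'r E0; have [a [b [ab b0 uE]]] := frac_coprime u.
have fps0 (q : {poly 'F_p}) : q != 0 -> poly_fps q != 0.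
  by apply: contraNneq => q0; apply/eqP/poly_fps_inj; rewrite q0 rmorph0.
have E1 : poly_fps b * \prod_i fm i ^+ e i = poly_fps a * \prod_i fm i ^+ e' i.
  apply/eqP; rewrite -tofrac_eq; apply/eqP; rewrite !tofracM !rmorph_prod.
  under eq_bigr do rewrite rmorphXn.
  under [in RHS]eq_bigr do rewrite rmorphXn.
  rewrite E0 uE ratfun_laurent_frac// mulrA mulrCA.
  by rewrite mulfV ?mulr1// tofrac_eq0 fps0.
(* Raising to the power [p.-1] replaces each series by the inverse of its truncation, so the
   relation becomes polynomial and the exponents change sides. *)
have E2 : b ^+ p.-1 * \prod_i A i ^+ e' i = a ^+ p.-1 * \prod_i A i ^+ e i.
  have := congr1 (fun g => g ^+ p.-1) E1; rewrite !exprMn => E2.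
  have mul_swap (B C X Y Q Q' : fps 'F_p) :
      B * X = C * Y -> X * Q = 1 -> Y * Q' = 1 -> B * Q' = C * Q.
    move=> BX XQ YQ; rewrite -[LHS]mulr1 -XQ -[RHS]mulr1 -YQ.
    by transitivity (B * X * Q * Q'); [ring | rewrite BX; ring].
  have K := kummer_prod e; have K' := kummer_prod e'.
  apply: poly_fps_inj; rewrite /= (rmorphM (@poly_fps _)) [RHS](rmorphM (@poly_fps _)).
  rewrite (rmorphXn (@poly_fps _)) [in RHS](rmorphXn (@poly_fps _)).
  exact: (mul_swap _ _ _ _ _ _ E2 K K').
have pF : p \in [pchar 'F_p] by apply: pchar_Fp.
have A0 (d : 'I_s -> nat) : \prod_i A i ^+ d i != 0.
  by apply/prodf_neq0 => i _; rewrite expf_neq0// trunc_mult_pneq0.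
have a0 : a != 0.
  apply/eqP => a0; move/eqP: E2; apply/negP.
  rewrite a0 expr0n gtn_eqF ?mul0r ?mulf_neq0 ?expf_neq0//.
  exact: leq_ltn_trans er.
(* Multiplicities are counted in an algebraic closure, where [trunc_mult_mup] bounds those of [A i]
   by [r i]. *)
have [E [f _]] := countable_algebraic_closure 'F_p.
have pE : p \in [pchar E] by apply: (rmorph_pchar f).
have mupV (d : 'I_s -> nat) : (\sum_i d i * r i < p.-1)%N ->
    forall x, (mup x (map_poly f (\prod_i A i ^+ d i)) < p.-1)%N.
  move=> dr x; apply: leq_ltn_trans dr; rewrite rmorph_prod /=.
  under eq_bigr do rewrite rmorphXn /= map_trunc_mult.
  rewrite mup_prod_exp => [|i]; last exact: trunc_mult_pneq0.
  apply: leq_sum => i _; rewrite leq_mul2l; apply/orP; right.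
  case/andP: (r_bound i) => r2 rp; rewrite -(ltn_predK r2).
  apply: leq_trans (leqnSn _); apply/ltnW/trunc_mult_mup => //; last by rewrite (ltn_predK r2).
  by rewrite -ltnS (ltn_predK r2).
have ba : coprimep b a by rewrite coprimep_sym.
have /eqP/size_poly1P[c c0 bc] := coprime_expr_const ab a0 b0 (A0 e') (A0 e) (mupV e er) E2.
have /eqP/size_poly1P[d d0 ad] :=
  coprime_expr_const ba b0 a0 (A0 e) (A0 e') (mupV e' e'r) (esym E2).
by exists (c, d); rewrite // -bc -ad.
Qed.

End MonomialRelations.

Lemma coef_sum_fps (R : zmodType) (I : finType) (g : I -> fps R) m :
  (\sum_i g i) m = \sum_i g i m.
Proof. exact: (big_morph (fun f : fps R => f m) (fun f g => coef_fpsD f g m) (coef_fps0 R m)). Qed.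

Lemma coef_fpsMn (R : zmodType) (g : fps R) k m : (g *+ k) m = g m *+ k.
Proof. by elim: k => // k IHk; rewrite !mulrS coef_fpsD IHk. Qed.

Lemma fps_mod_log_num p n (f : 'I_n -> fps int) i :
  fps_mod p (log_num f i) = log_num (fun j => fps_mod p (f j)) i.
Proof.
rewrite /log_num rmorphM rmorph_prod; congr (_ * _).
by apply: fpsP => m /=; rewrite rmorphMn.
Qed.

Lemma fps_euler_const (R : comNzRingType) (c : R) f :
  fps_euler (poly_fps c%:P * f) = poly_fps c%:P * fps_euler f.
Proof.
rewrite fps_eulerM; have -> : fps_euler (poly_fps c%:P) = 0.
  by apply: fpsP => -[|i] /=; rewrite ?mulr0n// coefC mul0rn.
by rewrite mul0r add0r.
Qed.

(** Applying [fps_euler] to a relation with constant coefficients gives a linear relation modulo [p]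
    between logarithmic derivatives, with coefficients [e i - e' i]. So [p] divides these
    differences, and exponents below [p] are then equal. *)
Lemma multinomial_monomials_independent s (r : 'I_s -> nat) :
  injective r -> (forall i, (2 < r i)%N) ->
  exists B, forall p, prime p -> (B <= p)%N -> forall (e e' : 'I_s -> nat) u,
    (\sum_i e i * r i < p.-1)%N -> (\sum_i e' i * r i < p.-1)%N ->
    \prod_i tofrac (fps_mod p (multinomial_fps (r i))) ^+ e i
    = ratfun_laurent u * \prod_i tofrac (fps_mod p (multinomial_fps (r i))) ^+ e' i ->
    e =1 e'.
Proof.
move=> rI r2; pose H i m := log_num (fun i => multinomial_fps (r i)) i m.
have [c cH|D D0 Dp] := @independent_modp s H.
  apply: (@log_num_independent s r) => // [i|]; first exact: ltnW.
  apply: fpsP => m; rewrite coef_sum_fps -[RHS](cH m).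
  apply: eq_bigr => i _; rewrite /H; case: (c i) => k.
    by rewrite -pmulrn coef_fpsMn -mulr_natr natz.
  by rewrite NegzE mulrNz -pmulrn coef_fpsN coef_fpsMn -mulr_natr natz mulrN.
(* This makes [p] exceed every [r i] and not divide [D]. *)
exists (`|D| + \sum_i r i).+1%N => p pP Bp e e' u er e'r.
have rp i : (2 < r i < p)%N.
  rewrite r2 (leq_ltn_trans _ Bp)// (leq_trans _ (leq_addl _ _))//.
  by rewrite (bigD1 i)//= leq_addr.
have pD : ~~ (p %| D)%Z.
  rewrite dvdzE /= gtnNdvd ?absz_gt0//.
  by rewrite (leq_ltn_trans _ Bp)// leq_addr.
case/(monomial_relation_const pP rp er e'r) => -[a b] /= [a0 b0].
pose f i := fps_mod p (multinomial_fps (r i)).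
rewrite -/(f _); set X := \prod_i f i ^+ e i; set Y := \prod_i f i ^+ e' i => aXbY.
have f0 i : f i != 0 by exact: fps_mod_multinomial_neq0.
have aX0 : poly_fps a%:P * X != 0.
  rewrite mulf_neq0//; last by apply/prodf_neq0 => i _; rewrite expf_neq0.
  by apply: contraNneq a0 => a0; rewrite -polyC_eq0; apply/eqP/poly_fps_inj; rewrite a0 rmorph0.
have HH : \sum_i log_num f i *+ e i = \sum_i log_num f i *+ e' i.
  apply: (mulIf aX0).
  transitivity (poly_fps a%:P * ((\prod_i f i) * fps_euler X)).
    by rewrite euler_prod_exp -/X mulrCA.
  rewrite mulrCA -fps_euler_const aXbY fps_euler_const mulrCA.
  by rewrite euler_prod_exp -/Y mulrCA.
have pF := pchar_Fp pP.
have pee i : (p %| (e i)%:Z - (e' i)%:Z)%Z.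
  apply: (Dp p pP pD (fun i => (e i)%:Z - (e' i)%:Z)) => m.
  rewrite (dvdz_pcharf pF) rmorph_sum /=; apply/eqP.
  have /eqP := congr1 (fun g : fps 'F_p => g m) HH; rewrite -subr_eq0 !coef_sum_fps -sumrB.
  move/eqP => HHm; rewrite -[RHS]HHm; apply: eq_bigr => j _; rewrite !coef_fpsMn -fps_mod_log_num.
  by rewrite rmorphM rmorphB /= !pmulrn mulrBr !mulrzr.
have ep (d : 'I_s -> nat) i : (\sum_i d i * r i < p.-1)%N -> (d i < p)%N.
  move=> dr; apply: leq_trans (leq_pred p); apply: leq_ltn_trans dr.
  by rewrite (bigD1 i)//= (leq_trans _ (leq_addr _ _))// leq_pmulr// (ltn_trans _ (r2 i)).
move=> i; have := pee i; rewrite -eqz_mod_dvd !modz_small ?ltz_nat ?ep//.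
by move=> /eqP[].
Qed.

(** * Degree of the reduced sum *)

Lemma unity_root_ratfun p (w : {fraction (fps 'F_p)}) : prime p ->
  w ^+ p.-1 = 1 -> exists u, w = ratfun_laurent u.
Proof.
move=> pP w1; have p0 := prime_gt0 pP.
have wp : w ^+ p = w by rewrite -[RHS]mulr1 -w1 -exprS prednK.
pose g : {rmorphism 'F_p -> {fraction (fps 'F_p)}} :=
  (@tofrac _ \o (@poly_fps _ \o @polyC _)).
(* The polynomial ['X^p - 'X] splits over ['F_p], so its root [w] is a constant. *)
have := congr1 (fun q => (map_poly g q).[w]) (finField_genPoly 'F_p).
rewrite card_Fp// rmorphB rmorph_prod /= map_polyXn map_polyX !hornerE.
rewrite wp subrr horner_prod => /esym/eqP/prodf_eq0[c _].
rewrite rmorphB /= map_polyX map_polyC /= !hornerE subr_eq0 => /eqP ->.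
by exists (tofrac c%:P); rewrite ratfun_laurent_tofrac.
Qed.

(** For the least [m] with [p <= m ^ 2], one has [m > C + 2] and [m * C < (m - 1) ^ 2 <= p - 1]. *)
Lemma sqrt_window C p : ((C + 2) ^ 2 < p)%N ->
  exists m, [/\ (1 < m)%N, (p <= m ^ 2)%N & (m * C < p.-1)%N].
Proof.
move=> Cp; have exm : exists m, (p <= m ^ 2)%N.
  by exists p; rewrite -mulnn leq_pmulr// (leq_trans _ Cp).
case: (ex_minnP exm) => m pm mmin; exists m.
have m1 : (C + 2 < m)%N.
  by rewrite -(ltn_exp2r _ _ (isT : 0 < 2)%N); apply: leq_trans pm.
have : (m.-1 ^ 2 < p)%N.
  by rewrite ltnNge; apply/negP => /mmin; lia.
by split=> //; nia.
Qed.

Lemma multinomial_sum_degree (R : realType) s : (0 < s)%N ->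
  exists S : seq nat, forall p : nat, prime p -> p \notin S ->
    exists2 d : nat, algebraic_of_degree (fps_mod p (multinomial_sum s)) d
      & (p%:R : R) `^ (s%:R / 2) <= d%:R.
Proof.
move=> s0; pose r (i : 'I_s) := (6 + i)%N.
have rI : injective r by move=> i j /addnI /val_inj.
have r2 i : (2 < r i)%N by [].
have [B HB] := multinomial_monomials_independent rI r2.
pose C := (\sum_i r i)%N.
(* Primes outside this list are at least [B] and exceed [(C + 2) ^ 2], as [sqrt_window] requires. *)
exists (iota 0 (maxn B ((C + 2) ^ 2).+1)) => p pP.
rewrite mem_iota add0n -leqNgt /= geq_max => /andP[Bp Cp].
have [m [m1 pm mC]] := sqrt_window Cp.
pose phi i := tofrac (fps_mod p (multinomial_fps (r i))).
have sumE : tofrac (fps_mod p (multinomial_sum s)) = \sum_i phi i.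
  rewrite /phi -!rmorph_sum; congr (tofrac (fps_mod p _)).
  rewrite /multinomial_sum -{1}[6%N]add0n big_addn addKn big_mkord.
  by apply: eq_bigr => i _; rewrite addnC.

have phi0 i : phi i != 0 by rewrite tofrac_eq0 fps_mod_multinomial_neq0.
have phih i : phi i ^+ p.-1 = ratfun_laurent ((tofrac (trunc_mult 'F_p p (r i)))^-1).
  rewrite [RHS]fmorphV /= ratfun_laurent_tofrac; apply/esym/mulr1_eq.
  by rewrite -rmorphXn mulrC -tofracM multinomial_kummer// tofrac1.
have pM : p \in [pchar {fraction (fps 'F_p)}].
  by apply: (rmorph_pchar (@tofrac (fps 'F_p))); apply: pchar_fps.
have algF : algebraicOver (@ratfun_laurent 'F_p) (\sum_i phi i).
  elim/big_ind: _ => [|x y|i _]; [exact: algebraic0 | exact: algebraic_add |].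
  have p1 : (0 < p.-1)%N by move: (prime_gt1 pP); case: (p) => [|[]].
  exists ('X^(p.-1) - ((tofrac (trunc_mult 'F_p p (r i)))^-1)%:P);
    first by rewrite -size_poly_gt0 size_XnsubC.
  by rewrite rmorphB /= map_polyXn map_polyC rootE hornerD hornerN hornerC hornerXn phih subrr.
have [P [Pmonic rootP Pmin]] := minimal_polynomial_ex algF.
have mP : (m ^ s < size P)%N.
  apply: (degree_lower_bound pM _ m1 phi0 phih _ (monic_neq0 Pmonic) rootP).
    by move=> w; apply: unity_root_ratfun.
  move=> e e' u ee'; have mon_small (d : {ffun 'I_s -> 'I_m}) : (\sum_i d i * r i < p.-1)%N.
    apply: leq_ltn_trans mC; rewrite big_distrr /=.
    by apply: leq_sum => i _; rewrite leq_mul2r (ltnW (ltn_ord _)) orbT.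
  apply/ffunP => i; apply: val_inj.
  exact: (HB p pP Bp (fun i => e i) (fun i => e' i) u (mon_small e) (mon_small e') ee').
exists (size P).-1.
  exists P; last by rewrite (ltn_predK mP).
  by split; [exact: Pmonic | rewrite sumE | rewrite sumE].
apply: (@le_trans _ _ (m ^ s)%:R); last by rewrite ler_nat -ltnS (ltn_predK mP).
have -> : (m ^ s)%:R = (m%:R ^+ 2 : R) `^ (s%:R / 2).
  rewrite -powR_mulrn ?ler0n// -powRrM mulrC divfK ?pnatr_eq0//.
  by rewrite powR_mulrn ?ler0n// natrX.
apply: ge0_ler_powR; rewrite ?nnegrE ?divr_ge0 ?exprn_ge0 ?ler0n//.
by rewrite -natrX ler_nat.
Qed.

(** * Diagonals *)

Section Geometric.
Variables (R : comNzRingType) (k : nat) (S : {mpoly R[k]}).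
Hypothesis S0 : S@_0%MM = 0.

Lemma mcoeff_exp_low n m : (mdeg m < n)%N -> (S ^+ n)@_m = 0.
Proof.
elim: n m => // n IHn m mn; rewrite exprS mcoeffM big1// => -[h1 h2] /= /eqP mh.
have [h10|h1n0] := eqVneq (h1 : 'X_{1..k}) 0%MM; first by rewrite h10 S0 mul0r.
have mE : mdeg m = (mdeg h1 + mdeg h2)%N by rewrite -mdegD -mh.
have h1_gt0 : (0 < mdeg h1)%N by rewrite lt0n mdeg_eq0.
have h2m : (mdeg h2 < mdeg h1 + mdeg h2)%N by rewrite -[X in (X < _)%N]add0n ltn_add2r.
by rewrite IHn ?mulr0// -ltnS; apply: leq_trans mn; rewrite ltnS -mE in h2m *.
Qed.

(** The inverse of [1 - S]: as [S] has no constant term, its powers beyond [mdeg m] do not reach the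
    monomial [m]. *)
Definition geometric_mfps : mfps R k :=
  MFPS (fun m => \sum_(n < (mdeg m).+1) (S ^+ n)@_m).

Lemma mcoeff_geometric N m : (mdeg m < N)%N ->
  geometric_mfps m = (\sum_(n < N) S ^+ n)@_m.
Proof.
move=> mN; rewrite raddf_sum /= -(subnKC mN) big_split_ord /=.
by rewrite [X in _ + X]big1 ?addr0// => i _; rewrite mcoeff_exp_low// leq_addr.
Qed.

Lemma geometric_is_ratio : is_ratio 1 (1 - S) geometric_mfps.
Proof.
split.
  apply/eqP => /(congr1 (mcoeff 0%MM)) /eqP.
  by rewrite mcoeffB mcoeff1 eqxx S0 subr0 mcoeff0 oner_eq0.
apply: mfpsP => m; pose N := (mdeg m).+1.
transitivity (((1 - S) * \sum_(n < N) S ^+ n)@_m).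
  rewrite mcoeffM; apply: eq_bigr => -[h1 h2] _ /=.
  by rewrite -(mcoeff_geometric (bmdeg h2)).
have -> : (1 - S) * \sum_(n < N) S ^+ n = 1 - S ^+ N.
  by rewrite -[RHS]opprB subrX1 -mulNr opprB.
by rewrite mcoeffB mcoeff_exp_low ?subr0.
Qed.

End Geometric.

(** The multinomial theorem with denominators cleared. Removing one factor ['X_j] contributes the
    weight [h j], and these weights sum to [mdeg h]. *)
Lemma mcoeff_multinomial (R : comNzRingType) r n (h : 'X_{1..r}) :
  ((\sum_(j < r) 'X_j : {mpoly R[r]}) ^+ n)@_h * (\prod_j (h j)`!)%:R
  = if mdeg h == n then n`!%:R else 0.
Proof.
elim: n h => [|n IHn] h.
  rewrite expr0 mcoeff1 mdeg_eq0; case: eqP => [->|_]; last by rewrite mul0r.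
  by rewrite big1 ?mulr1// => j _; rewrite mnm0E.
rewrite exprSr mulr_sumr raddf_sum mulr_suml /=.
transitivity (\sum_(j < r) (h j)%:R * (if mdeg h == n.+1 then n`!%:R else 0) : R).
  apply: eq_bigr => j _; have [hj0|hj0] := posnP (h j).
    rewrite hj0 mul0r mcoeffM big1 ?mul0r// => -[k1 k2] /= /eqP hk.
    rewrite mcoeffX; case: eqP => [k2j|_]; last by rewrite mulr0.
    have := congr1 (fun h' : 'X_{1..r} => h' j) hk.
    by rewrite hj0 mnmDE -k2j mnm1E eqxx addn1.
  have hE : h = (U_(j) + (h - U_(j)))%MM.
    apply/mnmP => i; rewrite mnmDE mnmBE mnm1E; case: eqP => [<-|_]; last by rewrite subn0.
    by rewrite subnKC.
  set h' := (h - U_(j))%MM in hE.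
  have h'j : h' j = (h j).-1 by rewrite mnmBE mnm1E eqxx subn1.
  have prodE : (\prod_i (h i)`! = h j * \prod_i (h' i)`!)%N.
    rewrite (bigD1 j)//= [in RHS](bigD1 j)//= mulnA; congr (_ * _)%N.
      by rewrite h'j -[in LHS](prednK hj0) factS prednK.
    by apply: eq_bigr => i ij; rewrite mnmBE mnm1E eq_sym (negPf ij) subn0.
  have cE (p : {mpoly R[r]}) : (p * 'X_j)@_h = p@_h' by rewrite [in LHS]hE mcoeffMX.
  have dE : mdeg h = (mdeg h').+1 by rewrite [in LHS]hE mdegD mdeg1.
  by rewrite cE prodE natrM mulrCA IHn dE eqSS.
rewrite -mulr_suml -natr_sum -mdegE; case: eqP => [->|_]; last by rewrite mulr0.
by rewrite -natrM -factS.
Qed.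

Section Diagonal.
Variables (r k : nat).
Hypotheses (r_gt0 : (0 < r)%N) (rk : (r <= k)%N).

(* Grouping the variables of index at least [r - 1] into one monomial makes
   [multinomial_fps r] a diagonal in [k] variables for every [k >= r]. *)
Definition grouped_var (j : 'I_r) : 'X_{1..k} := [multinom (minn i r.-1 == j : nat) | i < k].

Definition grouped_sum : {mpoly int[k]} := \sum_(j < r) 'X_[grouped_var j].

Let min_lt (i : nat) : (minn i r.-1 < r)%N.
Proof. by rewrite gtn_min ltn_predL r_gt0 orbT. Qed.

Lemma grouped_sum_exp n : grouped_sum ^+ n
  = (\sum_(j < r) 'X_j : {mpoly int[r]}) ^+ n \mPo [tuple 'X_[grouped_var j] | j < r].
Proof.
rewrite rmorphXn rmorph_sum; congr (_ ^+ _); apply: eq_bigr => j _.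
by rewrite /= comp_mpolyXU -tnth_nth tnth_mktuple.
Qed.

(** The substitution sends ['X_[h]] to the monomial with exponent [h (minn i r.-1)] at [i]. As
    [r <= k], all its exponents equal [m] exactly when those of [h] do. *)
Lemma mcoeff_grouped_sum n m : (grouped_sum ^+ n)@_[multinom m | _ < k]
  = ((\sum_(j < r) 'X_j : {mpoly int[r]}) ^+ n)@_[multinom m | _ < r].
Proof.
rewrite grouped_sum_exp; set P := _ ^+ n; rewrite comp_mpolyEX raddf_sum /=.
have coefX (h : 'X_{1..r}) :
    ('X_[h] \mPo [tuple 'X_[grouped_var j] | j < r] : {mpoly int[k]})@_[multinom m | _ < k]
    = (h == [multinom m | _ < r])%:R.
  rewrite comp_mpolyX.
  under eq_bigr do rewrite tnth_mktuple mpolyXn.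
  rewrite -(big_morph (@mpolyX k int) (@mpolyXD k int) (@mpolyX0 k int)) mcoeffX.
  congr (_%:R); congr nat_of_bool.
  have sumE (i : 'I_k) : (\sum_j (grouped_var j *+ h j))%MM i = h (Ordinal (min_lt i)).
    rewrite mnm_sumE (bigD1 (Ordinal (min_lt i))) //= mulmnE mnmE eqxx mul1n.
    rewrite big1 ?addn0// => j; rewrite -val_eqE /= => ji.
    by rewrite mulmnE mnmE eq_sym (negPf ji).
  apply/eqP/eqP => /mnmP E; apply/mnmP => i.
    have := E (widen_ord rk i); rewrite sumE !mnmE => <-; congr (h _).
    by apply: val_inj; rewrite /= (minn_idPl _)// -ltnS (ltn_predK r_gt0).
  by rewrite sumE E !mnmE.
under eq_bigr do rewrite mcoeffZ coefX.
have [Pm|Pm] := boolP ([multinom m | _ < r] \in msupp P).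
  rewrite (bigD1_seq _ Pm (msupp_uniq P)) /= eqxx mulr1 big1 ?addr0// => h hm.
  by rewrite (negPf hm) mulr0.
rewrite (memN_msupp_eq0 Pm) big_seq big1// => h hP.
by case: eqP => [hm|_]; rewrite ?mulr0//; rewrite -hm hP in Pm.
Qed.

Lemma grouped_sum0 : grouped_sum@_0%MM = 0.
Proof.
rewrite raddf_sum big1//= => j _; rewrite mcoeffX; case: eqP => // /mnmP.
move/(_ (widen_ord rk j)); rewrite mnmE mnm0E /= (minn_idPl _) ?eqxx//.
by rewrite -ltnS (ltn_predK r_gt0).
Qed.

Lemma diagonal_grouped : multinomial_fps r = diagonal (geometric_mfps grouped_sum).
Proof.
apply: fpsP => m; rewrite /=.
have degm d : mdeg [multinom m | _ < d] = (d * m)%N.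
  by rewrite mdegE; under eq_bigr do rewrite mnmE; rewrite sum_nat_const card_ord.
under eq_bigr do rewrite mcoeff_grouped_sum.
have mcE n := @mcoeff_multinomial int r n [multinom m | _ < r].
have prodE : (\prod_(j < r) ([multinom m | _ < r] j)`! = m`! ^ r)%N.
  by under eq_bigr do rewrite mnmE; rewrite prod_nat_const card_ord.
have f0 : (m`! ^ r)%:R != 0 :> int by rewrite pnatr_eq0 expn_eq0 (gtn_eqF (fact_gt0 m)).
have rm : (r * m < (mdeg [multinom m | _ < k]).+1)%N by rewrite degm ltnS leq_mul2r rk orbT.
have termE n : ((\sum_(j < r) 'X_j : {mpoly int[r]}) ^+ n)@_[multinom m | _ < r]
    = if (r * m == n)%N then (mult_coef r m)%:Z else 0.
  apply: (mulIf f0); rewrite -prodE mcE degm prodE; case: eqP => [<-|_]; last by rewrite mul0r.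
  by rewrite -mult_coef_fact natrM -(natz (mult_coef r m)).
under eq_bigr do rewrite termE.
by rewrite -big_mkcond (big_pred1 (Ordinal rm)).
Qed.

End Diagonal.

Lemma multinomial_diagonal r : (0 < r)%N -> exists2 g : mfps int r,
  is_ratio 1 (1 - \sum_(i < r) 'X_i) g & multinomial_fps r = diagonal g.
Proof.
move=> r0; exists (geometric_mfps (grouped_sum r r)); last exact: diagonal_grouped.
(* For [k = r] the grouping is trivial. *)
have -> : \sum_(i < r) 'X_i = grouped_sum r r.
  apply: eq_bigr => j _; congr mpolyX; apply/mnmP => i.
  rewrite mnm1E mnmE (minn_idPl _); first by rewrite -val_eqE; congr nat_of_bool; exact: eq_sym.
  by rewrite -ltnS (ltn_predK r0).
exact/geometric_is_ratio/grouped_sum0.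
Qed.

Lemma rational_mfpsD (R : idomainType) k (g h : mfps R k) :
  rational_mfps g -> rational_mfps h -> rational_mfps (g + h).
Proof.
move=> [P [Q [Q0 QP]]] [P' [Q' [Q'0 QP']]].
exists (P * Q' + P' * Q), (Q * Q'); split; first by rewrite mulf_neq0.
rewrite rmorphD !rmorphM /= -QP -QP'; ring.
Qed.

(** The diagonals are added in a common number of variables, [6 + s], which exceeds every [r] in the
    sum. *)
Lemma multinomial_sum_diagonal s : exists k, (0 < k)%N /\
  exists2 g : mfps int k, rational_mfps g & multinomial_sum s = diagonal g.
Proof.
exists (6 + s)%N; split=> //.
exists (\sum_(6 <= r < 6 + s) geometric_mfps (grouped_sum r (6 + s))).
  rewrite big_seq; elim/big_ind: _ => [|g h|r].
  - by exists 0, 1; split; [exact: oner_neq0 | rewrite rmorph1 mul1r rmorph0].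
  - exact: rational_mfpsD.
  rewrite mem_index_iota => /andP[r6 rs].
  exists 1, (1 - grouped_sum r (6 + s)); apply: geometric_is_ratio.
  by apply: grouped_sum0; [exact: leq_trans r6 | exact: ltnW].
apply: fpsP => m; rewrite /multinomial_sum /=.
rewrite (big_morph (fun f : fps int => f m) (fun f g => coef_fpsD f g m) (coef_fps0 _ m)).
rewrite (big_morph (fun g : mfps int (6 + s) => g [multinom m | _ < 6 + s])
  (fun f g => erefl) erefl).
rewrite [LHS]big_seq [RHS]big_seq; apply: eq_bigr => r.
rewrite mem_index_iota => /andP[r6 rs].
have r0 : (0 < r)%N by exact: leq_trans r6.
by have := congr1 (fun f : fps int => f m) (diagonal_grouped r0 (ltnW rs)).
Qed.

Theorem theorem1p5 (R : realType) :
  [/\ (forall r : nat, (0 < r)%N ->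
        exists2 g : mfps int r,
          is_ratio 1 (1 - \sum_(i < r) 'X_i) g & multinomial_fps r = diagonal g),
      (forall s : nat, (0 < s)%N ->
        exists S : seq nat, forall p : nat, prime p -> p \notin S ->
          exists2 d : nat, algebraic_of_degree (fps_mod p (multinomial_sum s)) d
            & (p%:R : R) `^ (s%:R / 2) <= d%:R)
    & (forall N : R, 0 < N ->
        exists2 f : fps int,
          exists k : nat, (0 < k)%N /\
            exists2 g : mfps int k, rational_mfps g & f = diagonal g
        & exists S : seq nat, forall p : nat, prime p -> p \notin S ->
            exists2 d : nat, algebraic_of_degree (fps_mod p f) d
              & (p%:R : R) `^ N <= d%:R)].
Proof.
split=> [|s|N N0]; [exact: multinomial_diagonal | exact: multinomial_sum_degree |].
(* The Archimedean bound exceeds [N], hence so does [s / 2]. *)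
pose s := (2 * (Num.bound N).+1)%N; exists (multinomial_sum s).
  exact: multinomial_sum_diagonal.
have [//|S HS] := @multinomial_sum_degree R s.
exists S => p pP pS; have [d dF dp] := HS p pP pS; exists d => //.
apply: le_trans dp; apply: ler_powR; first by rewrite ler1n prime_gt0.
rewrite /s natrM mulrAC divff ?pnatr_eq0// mul1r.
by rewrite (le_trans (ltW (archi_boundP (ltW N0))))// ler_nat.
Qed.
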